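(* Let $k\ge1$, let $\gamma\in\mathbb{R}\setminus\{0,-1,-2,\dots\}$, let $\lambda_1,\dots,\lambda_k$ be distinct non-zero real numbers, and let ${\bf G_{k,\gamma}}=\{G_\gamma(x;\lambda_j)\}_{j=1}^k$, where $G_\gamma(x;\lambda)=\sum_{l=0}^\infty\frac{\lambda^l}{(\gamma)_l}\cos lx$. For a multi-index $(n,\overrightarrow m)\in\mathbb{Z}_+^{k+1}$, $\overrightarrow m=(m_1,\dots,m_k)\ne(0,\dots,0)$, satisfying the condition $n\ge m_j$ $(j=1,2,\dots,k)$, for all $n$, starting from some $n_0$, there exist trigonometric Hermite--Jacobi approximations $\{\widehat\pi^t_j(x;{\bf G_{k,\gamma}})\}_{j=1}^k$, and with the appropriate normalization their denominator can be represented in the form $$\widehat Q^t_m(x;{\bf G_{k,\gamma}})=Q_m(e^{ix};{\bf E_{k,\gamma}})\cdot\overline{Q_m(e^{ix};{\bf E_{k,\gamma}})}=\frac{1}{\Gamma^2(n+m+\gamma)}\left|\int_0^{+\infty}U_\gamma(t)e^{-t(\cos x+i\sin x)}\,dt\right|^2.$$ If, in addition, $0<\lambda_1<\lambda_2<\dots<\lambda_k$, then among $\{\widehat\pi^t_j(x;{\bf G_{k,\gamma}})\}_{j=1}^k$ there is a trigonometric Hermite--Jacobi approximation $\widehat\pi^t_j(x;{\bf G_{k,\gamma}})$ that is not a trigonometric Hermite--Padé approximation $\pi^t_j(x;{\bf G_{k,\gamma}})$.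
   Context: $\mathbb{Z}_+$ denotes the non-negative integers, $m=m_1+\dots+m_k$, $n_j=n+m-m_j$, $(\gamma)_0=1$, $(\gamma)_p=\gamma(\gamma+1)\cdots(\gamma+p-1)$, and $\Gamma$ is Euler's gamma function. A trigonometric polynomial of degree at most $N$ is $\sum_{p=-N}^Nu_pe^{ipx}$, $u_p\in\mathbb{C}$. The function $U_\gamma(t)=t^{n+\gamma-1}\prod_{p=1}^k(t-\lambda_p)^{m_p}$. The system ${\bf E_{k,\gamma}}=\{E_\gamma(\lambda_jz)\}_{j=1}^k$, where $E_\gamma(z)=\sum_{p=0}^\infty z^p/(\gamma)_p$. $Q_m(z;{\bf E_{k,\gamma}})$ denotes the (algebraic) Hermite--Padé denominator of this system for $(n,\overrightarrow m)$: a polynomial $Q_m\not\equiv0$ of degree at most $m$ for which there are polynomials $P^j_{n_j}$ with $\deg P^j_{n_j}\le n_j$ and $Q_m(z)E_\gamma(\lambda_jz)-P^j_{n_j}(z)=O(z^{n+m+1})$ for $j=1,\dots,k$ (a power series starting with the power $z^{n+m+1}$), normalized by $Q_m(0)=1$ (for $n\ge m_j-1$, $j=1,\dots,k$, such a solution is unique up to a factor and can be so normalized). Trigonometric Hermite--Jacobi approximations for $(n,\overrightarrow m)$ and a system ${\bf f^t}=(f^t_1,\dots,f^t_k)$ of trigonometric series: rational functions $\widehat\pi^t_j(x;{\bf f^t})=\widehat P^t_j(x)/\widehat Q^t_m(x)$, $j=1,\dots,k$, where $\widehat Q^t_m$, $\widehat P^t_j$ are trigonometric polynomials of degrees at most $m$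 and $n_j$ respectively, such that each $\widehat\pi^t_j$ can be represented by a trigonometric series and $f^t_j(x)-\widehat P^t_j(x)/\widehat Q^t_m(x)=\sum_{l=n+m+1}^\infty(\tilde a^j_l\cos lx+\tilde b^j_l\sin lx)$ for $j=1,\dots,k$. Trigonometric Hermite--Padé approximations for $(n,\overrightarrow m)$ and ${\bf f^t}$: fractions $\pi^t_j(x;{\bf f^t})=P^t_j(x)/Q^t_m(x)$, $j=1,\dots,k$, where $Q^t_m\not\equiv0$ is a trigonometric polynomial of degree at most $m$ and $P^t_j$ are trigonometric polynomials of degree at most $n_j$ such that $Q^t_m(x)f^t_j(x)-P^t_j(x)=\sum_{l=n+m+1}^\infty(\tilde a^j_l\cos lx+\tilde b^j_l\sin lx)$ for $j=1,\dots,k$.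
   Formalization: The integral diverges when cos x ≤ 0, so the integral formula is stated literally for cos x > 0, and for every real x with the integral replaced by its analytic continuation along the unit circle (holomorphic in ζ, z = e^ζ). *)

(* Defs.v *)
From HB Require Import structures.
From mathcomp Require Import all_boot all_order all_algebra.
From mathcomp Require Import all_classical all_reals all_analysis.
From mathcomp Require Export complex.

Set Implicit Arguments.
Unset Strict Implicit.
Unset Printing Implicit Defensive.

Import Order.TTheory GRing.Theory Num.Theory.
Import numFieldNormedType.Exports.

Local Open Scope classical_set_scope.
Local Open Scope complex_scope.
Local Open Scope ring_scope.

Definition Cexp (R : realType) (z : R[i]) : R[i] :=
  (expR (complex.Re z))%:C * (cos (complex.Im z) +i* sin (complex.Im z)).

Definition cis (R : realType) (x : R) : R[i] := cos x +i* sin x.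

(* (g)_p = g (g + 1) ... (g + p - 1) *)
Definition pochhammer (R : realType) (g : R) (p : nat) : R :=
  \prod_(i < p) (g + i%:R).

(* Euler's integral, which is Gamma(s) only for s > 0. *)
Definition EulerGamma (R : realType) (s : R) : R :=
  \int[@lebesgue_measure R]_(t in `]0, +oo[) (t `^ (s - 1) * expR (- t)).

(* Lebesgue integral of a complex-valued function; integrability is part of the
   relation, so that it never holds for a divergent integral. *)
Definition is_Cintegral (R : realType) (D : set R) (f : R -> R[i]) (v : R[i]) :=
  [/\ (@lebesgue_measure R).-integrable D (fun t => (complex.Re (f t))%:E),
      (@lebesgue_measure R).-integrable D (fun t => (complex.Im (f t))%:E)
    & v = (\int[@lebesgue_measure R]_(t in D) complex.Re (f t)) +i*
          (\int[@lebesgue_measure R]_(t in D) complex.Im (f t))].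

Definition mtotal (k : nat) (m : 'I_k -> nat) : nat := (\sum_j m j)%N.

(* n_j = n + m - m_j; the subtraction is never truncated since m_j <= m. *)
Definition ndeg (k n : nat) (m : 'I_k -> nat) (j : 'I_k) : nat :=
  (n + mtotal m - m j)%N.

Definition Ugamma (R : realType) (k : nat) (g : R) (lam : 'I_k -> R)
    (n : nat) (m : 'I_k -> nat) (t : R) : R :=
  t `^ (n%:R + g - 1) * \prod_(p < k) (t - lam p) ^+ m p.

(* The integral  int_0^oo U(t) e^{-tz} dt  converges only for Re z > 0.  Put
   z = e^zeta: it is then a holomorphic function of zeta in |Im zeta| < pi/2,
   and F is its entire continuation, unique by the identity theorem.  The values
   F (i x), x real, continue the integral at z = e^{ix} along the unit circle.
   In the variable z itself, the continuation is multivalued when g is not an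
   integer. *)
Definition laplace_continuation (R : realType) (U : R -> R)
    (F : R[i] -> R[i]) : Prop :=
  (forall zeta : R[i], derivable (F : R[i]^o -> R[i]^o) zeta 1) /\
  (forall zeta : R[i], `|complex.Im zeta| < pi / 2 ->
     is_Cintegral `[0, +oo[
       (fun t => (U t)%:C * Cexp (- (t%:C * Cexp zeta))) (F zeta)).

(* Algebraic Hermite--Pade denominators.  A power series is its coefficient
   sequence nat -> R[i]. *)

Definition Ecoef (R : realType) (g lam : R) (p : nat) : R[i] :=
  (lam ^+ p / pochhammer g p)%:C.

Definition HP_denominator (R : realType) (k : nat) (f : 'I_k -> nat -> R[i])
    (n : nat) (m : 'I_k -> nat) (Q : {poly R[i]}) : Prop :=
  [/\ Q != 0, (size Q <= (mtotal m).+1)%N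
    & exists P : 'I_k -> {poly R[i]}, forall j,
        (size (P j) <= (ndeg n m j).+1)%N /\
        forall l : nat, (l <= n + mtotal m)%N ->
          \sum_(q < l.+1) Q`_q * f j (l - q)%N = (P j)`_l].

Definition HP_denominator_normalized (R : realType) (k : nat)
    (f : 'I_k -> nat -> R[i]) (n : nat) (m : 'I_k -> nat) (Q : {poly R[i]}) :=
  HP_denominator f n m Q /\ Q.[0] = 1.

(* A (complex) trigonometric series is encoded by its exponential coefficients
   c : int -> R[i], standing for sum_p c_p e^{ipx}.  In the cosine/sine form
   a_l = c_l + c_{-l} and b_l = i (c_l - c_{-l}) for l >= 1, so the series has
   the form  sum_{l >= N+1} (a_l cos lx + b_l sin lx)  iff c_l = 0 for all
   |l| <= N. *)

(* sum_{p = -N}^N F_p *)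
Definition zsum (R : realType) (N : nat) (F : int -> R[i]) : R[i] :=
  \sum_(i < N.*2.+1) F (i%:Z - N%:Z).

Definition teval (R : realType) (N : nat) (c : int -> R[i]) (x : R) : R[i] :=
  zsum N (fun p => c p * cis (p%:~R * x)).

Definition tpoly (R : realType) (N : nat) (u : int -> R[i]) : Prop :=
  forall p : int, (N < `|p|)%N -> u p = 0.

(* The series converges to s x at every real x, through its symmetric partial
   sums, which are those of the cosine/sine form. *)
Definition represented_by (R : realType) (c : int -> R[i]) (s : R -> R[i]) :=
  forall x : R, (fun N => (teval N c x : R[i]^o)) @ \oo --> (s x : R[i]^o).

(* Product of a trigonometric polynomial of degree at most N by a
   trigonometric series. *)
Definition tmul (R : realType) (N : nat) (u c : int -> R[i]) (l : int) : R[i] :=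
  zsum N (fun p => u p * c (l - p)).

(* sum_{l >= 0} a_l cos lx, with cos lx = (e^{ilx} + e^{-ilx}) / 2 *)
Definition cos_series (R : realType) (a : nat -> R[i]) (p : int) : R[i] :=
  if p == 0 then a 0%N else a `|p|%N / 2.

Definition Gseries (R : realType) (g lam : R) : int -> R[i] :=
  cos_series (fun l => (lam ^+ l / pochhammer g l)%:C).

(* The denominator is required not to vanish on the real line, so that the
   quotient is a function there. *)
Definition HJ_approx (R : realType) (k : nat) (f : 'I_k -> int -> R[i])
    (n : nat) (m : 'I_k -> nat)
    (Q : int -> R[i]) (P : 'I_k -> int -> R[i]) : Prop :=
  [/\ tpoly (mtotal m) Q, forall j, tpoly (ndeg n m j) (P j),
      forall x : R, teval (mtotal m) Q x != 0
    & forall j, exists d : int -> R[i],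
        represented_by d
          (fun x => teval (ndeg n m j) (P j) x / teval (mtotal m) Q x) /\
        forall l : int, (`|l| <= n + mtotal m)%N -> f j l - d l = 0].

Definition HP_approx (R : realType) (k : nat) (f : 'I_k -> int -> R[i])
    (n : nat) (m : 'I_k -> nat)
    (Q : int -> R[i]) (P : 'I_k -> int -> R[i]) : Prop :=
  [/\ tpoly (mtotal m) Q, exists p, Q p != 0,
      forall j, tpoly (ndeg n m j) (P j)
    & forall j (l : int), (`|l| <= n + mtotal m)%N ->
        tmul (mtotal m) Q (f j) l - P j l = 0].

(* Equality P1 / Q1 = P2 / Q2 as fractions of trigonometric polynomials, of
   degrees at most a and b. *)
Definition same_fraction (R : realType) (a b : nat)
    (P1 Q1 P2 Q2 : int -> R[i]) : Prop :=
  forall x : R, teval a P1 x * teval b Q2 x = teval a P2 x * teval b Q1 x.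

(* Main.v *)
(* Write N = n + m.  Up to normalization the denominator is
   Q(z) = sum_q c_q (g)_(N-q) / (g)_N z^q, where sum_q c_q z^q is the product of
   the (1 - lam_j z)^(m_j): the Hermite--Pade conditions for E(lam_j z) are the
   vanishing of Euler-type derivatives of that product at 1 / lam_j, hence
   divisibility by the factors, which also yields uniqueness.

   The Laplace formula is the termwise identity
   int t^(a-1) e^(-tz) dt = Gamma(a) z^(-a), z = e^zeta, obtained from the
   differential equation satisfied by the integral along the path tau * zeta
   (differentiation under the integral and integration by parts).

   Q(z) differs from prod_j (1 - lam_j z / (N+g))^(m_j) by O(1/n) on the closed
   unit disk, uniformly in the multi-index, so it has no zero there for large n.
   Then P_j / Q has a power series converging on the unit circle, and its real
   part is the Hermite--Jacobi approximation.

   For the last claim take the least j with m_j <> 0.  The coefficient of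
   z^(N+1) in Q(z) E(lam_j z) - P_j(z) is, up to a factor, the integral of U over
   (0, lam_j), where U has constant sign, so it is nonzero.  If the approximation
   were of Hermite--Pade type with denominator Qt, then Qt (P_j / Q) would be a
   trigonometric polynomial, and comparing low order coefficients would force Qt
   to be a constant, hence zero since the N-th coefficient of G_j is nonzero. *)

Require Import Defs.
From HB Require Import structures.
From mathcomp Require Import all_boot all_order all_algebra.
From mathcomp Require Import all_classical all_reals all_analysis.
From mathcomp Require Import measurable_realfun.
From mathcomp Require Import ring lra zify.

Import Order.TTheory GRing.Theory Num.Theory.
Import numFieldNormedType.Exports.

Local Open Scope classical_set_scope.
Local Open Scope complex_scope.
Local Open Scope ring_scope.

Set Implicit Arguments.
Unset Strict Implicit.
Unset Printing Implicit Defensive.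

(** * Euler's integral along a ray *)

(** Apply 1 + x <= e^x at x = c t / b and raise to the power b; the constant is (b/c)^b. *)
Lemma powR_le_expR (R : realType) (b c : R) : 0 < b -> 0 < c ->
  exists2 C : R, 0 < C & forall t, 0 <= t -> t `^ b <= C * expR (c * t).
Proof.
move=> b0 c0; exists ((b / c) `^ b); first by rewrite powR_gt0 ?divr_gt0.
move=> t t0.
have cb0 : 0 < c / b by rewrite divr_gt0.
have h : t <= (b / c) * expR (c / b * t).
  rewrite -invf_div mulrC ler_pdivlMr // mulrC.
  by apply: le_trans (expR_ge1Dx _); rewrite lerDr ler01.
apply: le_trans (ge0_ler_powR (ltW b0) _ _ h) _; rewrite ?nnegrE ?t0 //.
  by rewrite mulr_ge0 ?expR_ge0 // ltW // divr_gt0.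
rewrite powRM ?expR_ge0 ?(ltW (divr_gt0 _ _)) // ler_pM2l ?powR_gt0 ?divr_gt0 //.
by rewrite -expRM mulrAC divfK ?gt_eqF.
Qed.

Lemma cvg_expRN_mul (R : realType) (c : R) : 0 < c ->
  expR (- (c * t)) @[t --> +oo] --> (0 : R).
Proof.
move=> c0.
by apply: (@cvg_comp _ _ _ (fun t => c * t) (fun t => expR (- t)) _ +oo);
  [exact: gt0_cvgMry | exact: cvgr_expR].
Qed.

Lemma Rintegral_expRN (R : realType) (c : R) : 0 < c ->
  (@lebesgue_measure R).-integrable `[0, +oo[ (EFin \o (fun t => expR (- (c * t)))) /\
  \int[@lebesgue_measure R]_(t in `[0, +oo[) expR (- (c * t)) = c^-1.
Proof.
move=> c0.
have cE : continuous (fun t : R => expR (- (c * t))).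
  by move=> t; apply: continuous_comp; [apply: cvgN; apply: cvgMl_tmp; exact: cvg_id
    | exact: continuous_expR].
have h : (\int[@lebesgue_measure R]_(t in `[0%R, +oo[) (expR (- (c * t)))%:E = (c^-1)%:E)%E.
  rewrite (@ge0_continuous_FTC2y _ _ (fun t => - c^-1 * expR (- (c * t))) 0 0).
  - by rewrite mulr0 oppr0 expR0 mulr1 sub0e -EFinN opprK.
  - by move=> t _; exact: expR_ge0.
  - exact: continuous_subspaceT.
  - by rewrite -[X in _ --> X](mulr0 (- c^-1)); apply: cvgMl_tmp; exact: cvg_expRN_mul.
  - by move=> t _; apply: ex_derive.
  - apply: cvg_at_right_filter; apply: cvgMl_tmp; exact: cE.
  - move=> t _; rewrite derive1E derive_val /= /GRing.scale /=.
    field; exact: lt0r_neq0.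
split; last by rewrite /Rintegral h.
apply/integrableP; split.
  by apply/measurable_EFinP; apply: measurable_funTS; exact: continuous_measurable_fun.
under eq_integral do rewrite /= ger0_norm ?expR_ge0 //.
by rewrite h ltry.
Qed.

(* The phase [phi] makes the kernel stable under differentiation: both the real
   and the imaginary part of [t^p e^{-tz}], z = c + is, and their derivatives
   are of this shape. *)
Definition laplace_kernel (R : realType) (p c s phi t : R) : R :=
  t `^ p * expR (- (c * t)) * cos (s * t + phi).

(** The fundamental theorem of calculus on the half-line is applied to a nonnegative integrand: the
    dominating function C e^{-ct}, of known integral C/c, is added to f and its integral subtracted
    at the end. *)
Lemma Rintegral_derive_eq0 (R : realType) (F f : R -> R) (C c : R) :
  0 < c -> (forall t : R, 0 <= t -> `|f t| <= C * expR (- (c * t))) ->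
  {within `[0, +oo[, continuous f} ->
  (forall t : R, 0 < t -> is_derive t 1 F (f t)) ->
  F t @[t --> (0 : R)^'+] --> F 0 -> F 0 = 0 -> F t @[t --> +oo] --> (0 : R) ->
  \int[@lebesgue_measure R]_(t in `[0, +oo[) f t = 0.
Proof.
move=> c0 fC cf dF F0 F00 Foo.
have [iE iEv] := Rintegral_expRN c0.
pose e t : R := C * expR (- (c * t)).
have cE : continuous e.
  by move=> t; apply: cvgMl_tmp; apply: continuous_comp;
    [apply: cvgN; apply: cvgMl_tmp; exact: cvg_id | exact: continuous_expR].
have mf : measurable_fun (`[0, +oo[ : set R) f.
  exact: (measurable_realfun.subspace_continuous_measurable_fun _ cf).
have ie : (@lebesgue_measure R).-integrable `[0, +oo[ (EFin \o e).
  have -> : EFin \o e = (fun t => C%:E * (EFin \o (fun t => expR (- (c * t)))) t)%E.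
    by apply/funext => t /=; rewrite EFinM.
  exact: integrableZl.
have if_ : (@lebesgue_measure R).-integrable `[0, +oo[ (EFin \o f).
  apply: (le_integrable _ _ _ ie) => //; first exact/measurable_EFinP.
  move=> t /=; rewrite in_itv/= andbT => t0.
  by rewrite lee_fin (le_trans (fC _ t0)) // ler_norm.
have : \int[@lebesgue_measure R]_(t in `[0, +oo[) (f t + e t) = C / c.
  rewrite (@Rintegral_ge0_continuous_FTC2y _ _
    (fun t => F t + (- (C / c)) * expR (- (c * t))) 0 0).
  - by rewrite F00 mulr0 oppr0 expR0; lra.
  - move=> t t0; rewrite -lerBlDr sub0r; have := fC t t0.
    by rewrite -/(e t) ler_norml => /andP[].
  - move: cf => /continuous_within_itvcyP[cf cf0]; apply/continuous_within_itvcyP.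
    split; first by move=> t t0; apply: cvgD; [exact: cf | exact: cE].
    by apply: cvgD => //; apply: cvg_at_right_filter; exact: cE.
  - rewrite -[X in _ --> X]addr0; apply: cvgD => //.
    rewrite -[X in _ --> X](mulr0 (- (C / c))); apply: cvgMl_tmp; exact: cvg_expRN_mul.
  - by move=> t t0; have ? := dF t t0; apply: ex_derive.
  - apply: cvgD => //; apply: cvg_at_right_filter; apply: cvgMl_tmp.
    by apply: continuous_comp;
      [apply: cvgN; apply: cvgMl_tmp; exact: cvg_id | exact: continuous_expR].
  - move=> t; rewrite in_itv/= andbT => t0; have ? := dF t t0.
    rewrite derive1E derive_val /= /GRing.scale /= /e.
    by field; exact: lt0r_neq0.
rewrite RintegralD // [X in _ + X](_ : _ = C / c); first by lra.
by rewrite /e RintegralZl // iEv.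
Qed.

(** Half of the exponential decay absorbs the power t^p, and the cosine is at most 1 in modulus, so
    the constant is independent of frequency and phase. *)
Lemma laplace_kernel_bound (R : realType) (p c : R) : 0 < p -> 0 < c ->
  exists2 C : R, 0 < C & forall s phi t : R, 0 <= t ->
    `|laplace_kernel p c s phi t| <= C * expR (- (c / 2 * t)).
Proof.
move=> p0 c0; have c20 : 0 < c / 2 by rewrite divr_gt0.
have [C C0 hC] := powR_le_expR p0 c20; exists C => // s phi t t0.
rewrite /laplace_kernel !normrM (ger0_norm (powR_ge0 _ _)) (ger0_norm (expR_ge0 _)).
have h1 : `|cos (s * t + phi)| <= 1.
  by rewrite ler_norml cos_geN1 cos_le1.
apply: (@le_trans _ _ (t `^ p * expR (- (c * t)))).
  by rewrite ler_piMr // mulr_ge0 ?powR_ge0 ?expR_ge0.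
have -> : - (c / 2 * t) = c / 2 * t + - (c * t) by lra.
by rewrite expRD mulrA ler_pM2r ?expR_gt0 // hC.
Qed.

Lemma is_derive_laplace_kernel (R : realType) (p c s phi t : R) : 0 < t ->
  is_derive t 1 (laplace_kernel p c s phi)
    (p * laplace_kernel (p - 1) c s phi t - c * laplace_kernel p c s phi t
      + s * laplace_kernel p c s (phi + pi / 2) t).
Proof.
move=> t0; have ? := is_derive1_powR p t0.
apply: is_derive_eq.
rewrite /laplace_kernel /GRing.scale /= addrA cosDpihalf.
by ring.
Qed.

Lemma laplace_kernel_at0 (R : realType) (p c s phi : R) : 0 < p ->
  laplace_kernel p c s phi t @[t --> (0 : R)^'+] --> laplace_kernel p c s phi 0 /\
  laplace_kernel p c s phi 0 = 0.
Proof.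
move=> p0; have h : laplace_kernel p c s phi 0 = 0.
  by rewrite /laplace_kernel powR0 ?gt_eqF // !mul0r.
split => //; rewrite h.
rewrite [X in _ --> X](_ : 0 = 0 * expR (- (c * 0)) * cos (s * 0 + phi));
  last by rewrite !mul0r.
rewrite /laplace_kernel; apply: cvgM; first apply: cvgM; first exact: powR_cvg0.
  apply: cvg_at_right_filter; apply: continuous_comp;
  [apply: cvgN; apply: cvgMl_tmp; exact: cvg_id | exact: continuous_expR].
apply: cvg_at_right_filter; apply: continuous_comp; last exact: continuous_cos.
by apply: cvgD; [apply: cvgMl_tmp; exact: cvg_id | exact: cvg_cst].
Qed.

Lemma laplace_kernel_continuous (R : realType) (p c s phi : R) : 0 < p ->
  {within `[0, +oo[, continuous (laplace_kernel p c s phi)}.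
Proof.
move=> p0; apply/continuous_within_itvcyP; split; last first.
  by have [] := laplace_kernel_at0 c s phi p0.
move=> t; rewrite in_itv/= andbT => t0.
have ? := is_derive_laplace_kernel p c s phi t0.
by apply/differentiable_continuous/derivable1_diffP; apply: ex_derive.
Qed.

Lemma laplace_kernel_integrable (R : realType) (p c s phi : R) :
  0 < p -> 0 < c ->
  (@lebesgue_measure R).-integrable `[0, +oo[ (EFin \o laplace_kernel p c s phi).
Proof.
move=> p0 c0; have [C C0 hC] := laplace_kernel_bound p0 c0.
have c20 : 0 < c / 2 by rewrite divr_gt0.
have [iE _] := Rintegral_expRN c20.
apply: (le_integrable _ _ _ (integrableZl _ C iE)) => //.
  apply/measurable_EFinP.
  apply: (measurable_realfun.subspace_continuous_measurable_fun) => //.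
  exact: laplace_kernel_continuous.
move=> t /=; rewrite in_itv/= andbT => t0.
by rewrite lee_fin (le_trans (hC _ _ _ t0)) // ler_norm.
Qed.

Definition laplace_int (R : realType) (p c s phi : R) : R :=
  \int[@lebesgue_measure R]_(t in `[0, +oo[) laplace_kernel p c s phi t.

(** The derivative of the kernel integrates to 0, the kernel vanishing at 0 and at infinity. With p
    > 1 the exponent p - 1 stays positive, so all the kernels involved are continuous at 0. *)
Lemma laplace_int_by_parts (R : realType) (p c s phi : R) : 1 < p -> 0 < c ->
  p * laplace_int (p - 1) c s phi =
  c * laplace_int p c s phi - s * laplace_int p c s (phi + pi / 2).
Proof.
move=> p1 c0; have p0 : 0 < p by apply: lt_trans p1.
have p10 : 0 < p - 1 by rewrite subr_gt0.
have c20 : 0 < c / 2 by rewrite divr_gt0.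
have i1 := laplace_kernel_integrable s phi p10 c0.
have i2 := laplace_kernel_integrable s phi p0 c0.
have i3 := laplace_kernel_integrable s (phi + pi / 2) p0 c0.
have [C1 C10 h1] := laplace_kernel_bound p10 c0.
have [C2 C20 h2] := laplace_kernel_bound p0 c0.
pose f t := p * laplace_kernel (p - 1) c s phi t - c * laplace_kernel p c s phi t
      + s * laplace_kernel p c s (phi + pi / 2) t.
have iZ k g : (@lebesgue_measure R).-integrable `[0, +oo[ (EFin \o g) ->
    (@lebesgue_measure R).-integrable `[0, +oo[ (EFin \o (fun t => k * g t)).
  move=> ig; have -> : EFin \o (fun t => k * g t) = (fun t => k%:E * (EFin \o g) t)%E.
    by apply/funext => t /=; rewrite EFinM.
  exact: integrableZl.
have e : \int[@lebesgue_measure R]_(t in `[0, +oo[) f t = 0.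
  apply: (@Rintegral_derive_eq0 _ (laplace_kernel p c s phi) _
    (p * C1 + c * C2 + `|s| * C2) (c / 2)) => //.
  - move=> t t0; rewrite /f (le_trans (ler_normD _ _)) // !mulrDl lerD //.
      rewrite (le_trans (ler_normB _ _)) //; apply: lerD; rewrite normrM.
        by rewrite (gtr0_norm p0) -[X in _ <= X]mulrA ler_pM2l // h1.
      by rewrite (gtr0_norm c0) -[X in _ <= X]mulrA ler_pM2l // h2.
    by rewrite normrM -[X in _ <= X]mulrA ler_wpM2l // h2.
  - apply/continuous_within_itvcyP.
    have /continuous_within_itvcyP[a1 b1] := @laplace_kernel_continuous _ _ c s phi p10.
    have /continuous_within_itvcyP[a2 b2] := @laplace_kernel_continuous _ _ c s phi p0.
    have /continuous_within_itvcyP[a3 b3] :=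
      @laplace_kernel_continuous _ _ c s (phi + pi / 2) p0.
    split => [t t0|].
      have cZ (k : R) (h : R -> R) : {for t, continuous h} -> {for t, continuous (fun t => k * h t : R)}.
        by move=> ch; apply: cvgMl_tmp.
      by apply: cvgD; [apply: cvgB|]; apply: cZ; [exact: a1|exact: a2|exact: a3].
    by apply: cvgD; [apply: cvgB|]; apply: cvgMl_tmp.
  - by move=> t t0; exact: is_derive_laplace_kernel.
  - by have [] := laplace_kernel_at0 c s phi p0.
  - by have [] := laplace_kernel_at0 c s phi p0.
  - apply: norm_cvg0.
    apply: (@squeeze_cvgr _ _ _ _ (cst 0) (fun t => C2 * expR (- (c / 2 * t)))).
    + near=> t; have t0 : 0 <= t by near: t; apply: nbhs_pinfty_ge; rewrite num_real.
      by rewrite normr_ge0 /= h2.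
    + exact: cvg_cst.
    + rewrite -[X in _ --> X](mulr0 C2); apply: cvgMl_tmp; exact: cvg_expRN_mul.
have i12 : (@lebesgue_measure R).-integrable `[0, +oo[ (EFin \o (fun t =>
    p * laplace_kernel (p - 1) c s phi t - c * laplace_kernel p c s phi t)).
  rewrite [X in _.-integrable _ X](_ : _ = (fun t =>
    (p * laplace_kernel (p - 1) c s phi t)%R%:E - (c * laplace_kernel p c s phi t)%R%:E)%E);
    last by apply/funext => t /=; rewrite EFinB.
  by apply: integrableB => //; [exact: (iZ p _ i1) | exact: (iZ c _ i2)].
move: e; rewrite /f (RintegralD _ i12 (iZ s _ i3)) //.
rewrite (RintegralB _ (iZ p _ i1) (iZ c _ i2)) //.
rewrite !RintegralZl // -!/(laplace_int _ _ _ _) => e.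
by lra.
Unshelve. all: end_near. Qed.

Lemma norm_cos_le1 (R : realType) (x : R) : `|cos x| <= 1.
Proof. by rewrite ler_norml cos_geN1 cos_le1. Qed.

Lemma norm_sin_le1 (R : realType) (x : R) : `|sin x| <= 1.
Proof. by rewrite ler_norml sin_geN1 sin_le1. Qed.

Lemma laplace_intDpi (R : realType) (p c s phi : R) : 0 < p -> 0 < c ->
  laplace_int p c s (phi + pi / 2 + pi / 2) = - laplace_int p c s phi.
Proof.
move=> p0 c0; rewrite -mulN1r -RintegralZl //; last exact: laplace_kernel_integrable.
apply: eq_Rintegral => t _; rewrite /laplace_kernel !addrA !cosDpihalf sinDpihalf.
by ring.
Qed.

(** Differentiation under the integral sign along a curve of parameters. Differentiating in c or s
    brings out a factor t, which raises the exponent from a - 1 to a; the sine is written as a phase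
    shift by pi/2. *)
Lemma derive_laplace_int (R : realType) (a u v : R) (c s phi c' s' phi' : R -> R)
    (c0 M : R) (x : R) :
  1 < a -> 0 < c0 -> x \in `]u, v[ ->
  (forall y, y \in `]u, v[ -> c0 <= c y) ->
  (forall y : R, y \in `]u, v[ -> is_derive y 1 c (c' y)) ->
  (forall y : R, y \in `]u, v[ -> is_derive y 1 s (s' y)) ->
  (forall y : R, y \in `]u, v[ -> is_derive y 1 phi (phi' y)) ->
  (forall y, y \in `]u, v[ -> [/\ `|c' y| <= M, `|s' y| <= M & `|phi' y| <= M]) ->
  is_derive x 1 (fun y => laplace_int (a - 1) (c y) (s y) (phi y))
    (- c' x * laplace_int a (c x) (s x) (phi x)
     + s' x * laplace_int a (c x) (s x) (phi x + pi / 2)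
     + phi' x * laplace_int (a - 1) (c x) (s x) (phi x + pi / 2)).
Proof.
move=> a1 c00 xuv hc dc ds dphi hM.
have a0 : 0 < a by apply: lt_trans a1.
have a10 : 0 < a - 1 by rewrite subr_gt0.
have M0 : 0 <= M by have [h _ _] := hM x xuv; apply: le_trans h.
pose f y t := laplace_kernel (a - 1) (c y) (s y) (phi y) t.
pose df y t : R := - c' y * laplace_kernel a (c y) (s y) (phi y) t
     + s' y * laplace_kernel a (c y) (s y) (phi y + pi / 2) t
     + phi' y * laplace_kernel (a - 1) (c y) (s y) (phi y + pi / 2) t.
have dfE (y t : R) : y \in `]u, v[ -> 0 <= t -> is_derive y 1 (f ^~ t) (df y t).
  move=> yI t0; have ? := dc y yI; have ? := ds y yI; have ? := dphi y yI.
  rewrite /f /laplace_kernel; apply: is_derive_eq.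
  rewrite /GRing.scale /= /df /laplace_kernel !addrA !cosDpihalf.
  by rewrite -(mulr_powRB1 t0 a0); ring.
(* Every decay rate on the interval is at least [c0], so kernels of rate [c0] with frequency and
   phase 0 dominate; the factor 2 accounts for the terms in [c'] and [s']. *)
pose G t := 2 * M * laplace_kernel a c0 0 0 t + M * laplace_kernel (a - 1) c0 0 0 t.
have c_gt0 y : y \in `]u, v[ -> 0 < c y by move=> yI; apply: lt_le_trans (hc y yI).
have iZ (k : R) (h : R -> R) : (@lebesgue_measure R).-integrable `[0, +oo[ (EFin \o h) ->
    (@lebesgue_measure R).-integrable `[0, +oo[ (EFin \o (fun t => k * h t)).
  move=> ig; have -> : EFin \o (fun t => k * h t) = (fun t => k%:E * (EFin \o h) t)%E.
    by apply/funext => t /=; rewrite EFinM.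
  exact: integrableZl.
have iD (h1 h2 : R -> R) : (@lebesgue_measure R).-integrable `[0, +oo[ (EFin \o h1) ->
    (@lebesgue_measure R).-integrable `[0, +oo[ (EFin \o h2) ->
    (@lebesgue_measure R).-integrable `[0, +oo[ (EFin \o (fun t => h1 t + h2 t)).
  move=> i1 i2.
  rewrite [X in _.-integrable _ X](_ : _ = (fun t => (h1 t)%:E + (h2 t)%:E)%E);
    last by apply/funext => t /=; rewrite EFinD.
  exact: integrableD.
have lk_le p y ps (t : R) : y \in `]u, v[ -> 0 <= t ->
    `|laplace_kernel p (c y) (s y) ps t| <= laplace_kernel p c0 0 0 t.
  move=> yI t0; rewrite /laplace_kernel mul0r addr0 cos0 mulr1 normrM.
  rewrite -[X in _ <= X]mulr1; apply: ler_pM => //; last exact: norm_cos_le1.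
  rewrite ger0_norm ?mulr_ge0 ?powR_ge0 ?expR_ge0 // ler_wpM2l ?powR_ge0 //.
  by rewrite ler_expR lerN2 ler_wpM2r // hc.
have lk0 p t : 0 <= laplace_kernel p c0 0 0 t.
  by rewrite /laplace_kernel mul0r addr0 cos0 mulr1 mulr_ge0 ?powR_ge0 ?expR_ge0.
have G0 t : 0 <= G t.
  by apply: addr_ge0; apply: mulr_ge0 => //; apply: mulr_ge0.
have iG : (@lebesgue_measure R).-integrable `[0, +oo[ (EFin \o G).
  by apply: iD; apply: iZ; exact: laplace_kernel_integrable.
have Dge (t : R) : (`[0, +oo[%classic : set R) t -> 0 <= t by rewrite /= in_itv/= andbT.
have intf y : (`]u, v[%classic : set R) y ->
    (@lebesgue_measure R).-integrable `[0, +oo[ (EFin \o f y).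
  by move=> yI; apply: laplace_kernel_integrable => //; exact: c_gt0.
have derf (y t : R) : (`]u, v[%classic : set R) y -> (`[0, +oo[%classic : set R) t -> derivable (f ^~ t) y 1.
  by move=> yI /Dge t0; have ? := dfE y t yI t0; apply: ex_derive.
have dE (y t : R) : y \in `]u, v[ -> 0 <= t -> partial1of2 f y t = df y t.
  by move=> yI t0; have ? := dfE y t yI t0; rewrite partial1of2E derive_val.
have Gub (y t : R) : (`]u, v[%classic : set R) y -> (`[0, +oo[%classic : set R) t -> `|partial1of2 f y t| <= G t.
  move=> yI /Dge t0; rewrite dE // /df /G.
  have [h1 h2 h3] := hM y yI.
  rewrite (le_trans (ler_normD _ _)) //; apply: lerD; last first.
    by rewrite normrM ler_pM // lk_le.
  rewrite (le_trans (ler_normD _ _)) // mulr2n !mulrDl mul1r.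
  by apply: lerD; rewrite normrM ?normrN ler_pM // lk_le.
pose F y := \int[@lebesgue_measure R]_(t in `[0, +oo[) f y t.
have D : derivable F x 1.
  by apply: (derivable_under_integral _ xuv intf derf G0 iG Gub).
have E : derive1 F x = \int[@lebesgue_measure R]_(t in `[0, +oo[) partial1of2 f x t.
  by apply: (differentiation_under_integral _ xuv intf derf G0 iG Gub).
rewrite derive1E in E.
have H : is_derive x 1 F _ := DeriveDef D E.
rewrite -[fun y => laplace_int _ _ _ _]/F; apply: (is_derive_eq H).
transitivity (\int[@lebesgue_measure R]_(t in `[0, +oo[) df x t).
  by apply: eq_Rintegral => t; rewrite inE => /Dge t0; rewrite dE.
have cx0 := c_gt0 x xuv.
have i1 := laplace_kernel_integrable (s x) (phi x) a0 cx0.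
have i2 := laplace_kernel_integrable (s x) (phi x + pi / 2) a0 cx0.
have i3 := laplace_kernel_integrable (s x) (phi x + pi / 2) a10 cx0.
rewrite /df (RintegralD _ (iD _ _ (iZ (- c' x) _ i1) (iZ (s' x) _ i2)) (iZ (phi' x) _ i3)) //.
by rewrite (RintegralD _ (iZ (- c' x) _ i1) (iZ (s' x) _ i2)) // !RintegralZl.
Qed.

(** This is the real part of e^{-i psi} times the formula Gamma(a) z^{-a} for the integral of
    t^{a-1} e^{-tz}, at z = e^{rho + i theta}. The path y -> e^{y (rho + i theta)} joins 1 to z, and
    along it the integral satisfies a linear differential equation. *)
Lemma laplace_int_polar (R : realType) (a rho theta psi : R) :
  1 < a -> `|theta| < pi / 2 ->
  laplace_int (a - 1) (expR rho * cos theta) (expR rho * sin theta) psi =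
  expR (- (a * rho)) * laplace_int (a - 1) 1 0 0 * cos (psi + a * theta).
Proof.
move=> a1 ht.
have a0 : 0 < a by apply: lt_trans a1.
have a10 : 0 < a - 1 by rewrite subr_gt0.
have pi0 := pi_gt0 R.
pose c y : R := expR (rho * y) * cos (theta * y).
pose s y : R := expR (rho * y) * sin (theta * y).
(* The moving phase compensates the rotation by theta, which leaves the equation L' = - a rho L. *)
pose phi y : R := psi + a * theta - a * theta * y.
(* A margin beyond [0, 1] for which [|theta * y|] stays below [t1], the midpoint of |theta| and
   pi/2; the decay rate is then bounded below on an open interval containing both ends of the
   path. *)
pose d := (pi / 2 - `|theta|) / pi.
have d0 : 0 < d by rewrite divr_gt0 // subr_gt0.
have d12 : d <= 2^-1.
  by rewrite ler_pdivrMr // mulrC lerBlDr lerDl normr_ge0.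
pose t1 := (pi / 2 + `|theta|) / 2.
have t1_lt : t1 < pi / 2 by rewrite /t1; lra.
have t1_ge0 : 0 <= t1 by have := normr_ge0 theta; rewrite /t1; lra.
have y2 y : y \in `](- d), (1 + d)[ -> `|y| <= 1 + d.
  by rewrite in_itv/= ler_norml => /andP[h1 h2]; apply/andP; split; lra.
have ty y : y \in `](- d), (1 + d)[ -> `|theta * y| <= t1.
  move=> /y2 hy; rewrite normrM.
  apply: (@le_trans _ _ (`|theta| * (1 + d))); first by rewrite ler_wpM2l.
  have : `|theta| * d <= pi / 2 * d by rewrite ler_wpM2r // ltW.
  have : d * pi = pi / 2 - `|theta| by rewrite /d divfK // gt_eqF.
  by rewrite /t1; set w := `|theta|; clearbody d w; lra.
have ry y : y \in `](- d), (1 + d)[ -> `|rho * y| <= 2 * `|rho|.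
  by move=> /y2 hy; rewrite normrM mulrC ler_wpM2r //; lra.
pose c0 := expR (- (2 * `|rho|)) * cos t1.
have cost1 : 0 < cos t1 by apply: cos_gt0_pihalf; apply/andP; split; lra.
have c00 : 0 < c0 by rewrite mulr_gt0 ?expR_gt0.
have cc y : y \in `](- d), (1 + d)[ -> c0 <= c y.
  move=> yI; apply: ler_pM; rewrite ?expR_ge0 ?(ltW cost1) //.
    by rewrite ler_expR; have := ry y yI; rewrite ler_norml => /andP[].
  have -> : cos (theta * y) = cos `|theta * y|.
    by case: (ger0P (theta * y)) => // _; rewrite cosN.
  have h := ty y yI.
  have [<-//|ne] := eqVneq `|theta * y| t1.
  rewrite ltW // ltr_cos ?lt_neqAle ?ne ?h //; rewrite in_itv/= ?normr_ge0 /=; lra.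
pose E := expR (2 * `|rho|).
have ey y : y \in `](- d), (1 + d)[ -> `|c y| <= E /\ `|s y| <= E.
  move=> yI; have h : `|expR (rho * y)| <= E.
    by rewrite ger0_norm ?expR_ge0 // ler_expR (le_trans (ler_norm _)) // ry.
  by split; rewrite normrM -[E]mulr1 ler_pM // ?norm_cos_le1 ?norm_sin_le1.
pose M := (`|rho| + `|theta|) * E + a * `|theta|.
pose c' y := rho * c y - theta * s y.
pose s' y := rho * s y + theta * c y.
pose phi' (y : R) := - (a * theta).
have E0 : 0 <= E by exact: expR_ge0.
have hM y : y \in `](- d), (1 + d)[ ->
    [/\ `|c' y| <= M, `|s' y| <= M & `|phi' y| <= M].
  move=> /ey [h1 h2].
  have at0 : 0 <= a * `|theta| by rewrite mulr_ge0 // ltW.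
  split.
  - apply: (@le_trans _ _ ((`|rho| + `|theta|) * E)); last by rewrite /M lerDl.
    apply: le_trans (ler_normB _ _) _.
    by rewrite mulrDl (normrM rho) (normrM theta); apply: lerD; apply: ler_wpM2l.
  - apply: (@le_trans _ _ ((`|rho| + `|theta|) * E)); last by rewrite /M lerDl.
    apply: le_trans (ler_normD _ _) _.
    by rewrite mulrDl (normrM rho) (normrM theta); apply: lerD; apply: ler_wpM2l.
  - rewrite /phi' normrN normrM (gtr0_norm a0) /M lerDr.
    by apply: mulr_ge0 => //; apply: addr_ge0.
have dc (y : R) : y \in `](- d), (1 + d)[ -> is_derive y 1 c (c' y).
  by move=> _; apply: is_derive_eq; rewrite /GRing.scale /= /c' /c /s; ring.
have ds (y : R) : y \in `](- d), (1 + d)[ -> is_derive y 1 s (s' y).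
  by move=> _; apply: is_derive_eq; rewrite /GRing.scale /= /s' /c /s; ring.
have dphi (y : R) : y \in `](- d), (1 + d)[ -> is_derive y 1 phi (phi' y).
  by move=> _; apply: is_derive_eq; rewrite /GRing.scale /= /phi'; ring.
pose L y := laplace_int (a - 1) (c y) (s y) (phi y).
have dL (y : R) : y \in `](- d), (1 + d)[ -> is_derive y 1 L (- (rho * a * L y)).
  move=> yI; have cy0 : 0 < c y by apply: lt_le_trans (cc y yI).
  have h := derive_laplace_int a1 c00 yI cc dc ds dphi hM.
  apply: (is_derive_eq h).
  have p1 := laplace_int_by_parts (s y) (phi y) a1 cy0.
  have p2 := laplace_int_by_parts (s y) (phi y + pi / 2) a1 cy0.
  rewrite laplace_intDpi // in p2.
  rewrite /L /c' /s' /phi'; move: p1 p2.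
  set L0 := laplace_int (a - 1) _ _ (phi y).
  set L1 := laplace_int (a - 1) _ _ (phi y + _).
  set K0 := laplace_int a _ _ (phi y); set K1 := laplace_int a _ _ (phi y + _).
  move=> p1 p2; rewrite -(mulrA rho) p1.
  have -> : - (a * theta) * L1 = - theta * (c y * K1 - s y * - K0).
    by rewrite -p2; ring.
  by ring.
pose W y := expR (a * rho * y) * L y.
have dW (y : R) : y \in `](- d), (1 + d)[ -> is_derive y 1 W 0.
  move=> yI; have ? := dL y yI.
  by apply: is_derive_eq; rewrite /GRing.scale /=; ring.
have sub y : y \in `[0, 1] -> y \in `](- d), (1 + d)[.
  by rewrite !in_itv/= => /andP[h1 h2]; apply/andP; split; lra.
have dW' (y : R) : y \in `]0, 1[ -> is_derive y 1 W 0.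
  by move=> yI; apply: dW; apply: sub; exact: subset_itv_oo_cc yI.
have cW : {within `[0, 1], continuous W}.
  apply: derivable_within_continuous => y yI; have ? := dW y (sub y yI).
  exact: ex_derive.
(* [W] is constant: its value at 1 is e^{a rho} times the integral sought, and at 0 the integrand
   has frequency 0 and a fixed phase, whose cosine factors out. *)
have [x _] := @MVT _ W (fun=> 0) 0 1 ltr01 dW' cW.
rewrite mul0r /W /L /c /s /phi !mulr0 !mulr1 expR0 cos0 sin0 subr0 !mul1r addrK.
move/eqP; rewrite subr_eq0 => /eqP h.
have e0 : laplace_int (a - 1) 1 0 (psi + a * theta) =
    laplace_int (a - 1) 1 0 0 * cos (psi + a * theta).
  rewrite /laplace_int -RintegralZr //; last exact: laplace_kernel_integrable.
  apply: eq_Rintegral => t _.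
  by rewrite /laplace_kernel mul0r !add0r cos0 mulr1.
by rewrite -mulrA -e0 -h mulrA -expRD addNr expR0 mul1r.
Qed.

(** * The complex exponential *)

Lemma norm_real_complex (R : realType) (x : R) : `|x%:C| = `|x|%:C.
Proof. by rewrite normc_def /= expr0n /= addr0 sqrtr_sqr. Qed.

Lemma norm_complex_le (R : realType) (z : R[i]) (A B : R) :
  `|complex.Re z| <= A -> `|complex.Im z| <= B -> `|z| <= (A + B)%:C.
Proof.
move=> hA hB; rewrite {1}[z]complexE; apply: le_trans (ler_normD _ _) _.
rewrite rmorphD; apply: lerD; first by rewrite norm_real_complex lecR.
rewrite normrM norm_real_complex.
rewrite (_ : `|'i| = 1); first by rewrite mul1r lecR.
by rewrite normc_def /= expr0n /= add0r expr1n sqrtr1.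
Qed.

Lemma norm_ReIm_le (R : realType) (z : R[i]) (A : R) :
  `|z| <= A%:C -> `|complex.Re z| <= A /\ `|complex.Im z| <= A.
Proof.
rewrite normc_def lecR => h; split; apply: le_trans h;
  rewrite -sqrtr_sqr ler_sqrt ?addr_ge0 ?sqr_ge0 //.
  by rewrite lerDl sqr_ge0.
by rewrite lerDr sqr_ge0.
Qed.

Lemma CexpD (R : realType) (a b : R[i]) : Cexp (a + b) = Cexp a * Cexp b.
Proof.
case: a => a1 a2; case: b => b1 b2; rewrite /Cexp; simpc.
by rewrite /= expRD cosD sinD; congr (_ +i* _); ring.
Qed.

Lemma Cexp_real (R : realType) (x : R) : Cexp x%:C = (expR x)%:C.
Proof. by rewrite /Cexp /= cos0 sin0 complexr0 -rmorphM mulr1. Qed.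

Lemma Cexp0 (R : realType) : Cexp (0 : R[i]) = 1.
Proof. by rewrite -[0]/(0%:C) Cexp_real expR0. Qed.

Lemma norm_Cexp (R : realType) (z : R[i]) : `|Cexp z| = (expR (complex.Re z))%:C.
Proof.
rewrite /Cexp normrM norm_real_complex (ger0_norm (expR_ge0 _)).
by rewrite [`|_ +i* _|]normc_def /= cos2Dsin2 sqrtr1 mulr1.
Qed.

Lemma cisE (R : realType) (x : R) : cis x = Cexp (0 +i* x).
Proof. by rewrite /Cexp /= expR0 mul1r. Qed.

Lemma cisD (R : realType) (x y : R) : cis (x + y) = cis x * cis y.
Proof. by rewrite !cisE -CexpD; congr Cexp; apply/eqP; rewrite eq_complex /= addr0 !eqxx. Qed.

Lemma cis0 (R : realType) : cis (0 : R) = 1.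
Proof. by rewrite cisE Cexp0. Qed.

Lemma norm_cis (R : realType) (x : R) : `|cis x| = 1.
Proof. by rewrite cisE norm_Cexp expR0. Qed.

Lemma cisN (R : realType) (x : R) : cis (- x) = (cis x)^-1.
Proof.
have h : cis (- x) * cis x = 1 by rewrite -cisD addNr cis0.
have : cis x != 0 by rewrite -normr_eq0 norm_cis oner_eq0.
by move=> h0; apply: (mulIf h0); rewrite h mulVf.
Qed.

Lemma conj_cis (R : realType) (x : R) : (cis x)^* = cis (- x).
Proof. by rewrite /cis cosN sinN. Qed.

Lemma cis_nat (R : realType) (n : nat) (x : R) : cis (n%:R * x) = cis x ^+ n.
Proof.
elim: n => [|n IH]; first by rewrite mul0r cis0.
by rewrite exprS -IH -cisD -natr1 mulrDl mul1r addrC.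
Qed.

Lemma ler_norm_derive (R : realType) (f df : R -> R) (x K : R) :
  (forall y : R, is_derive y 1 f (df y)) ->
  (forall y, `|y| <= `|x| -> `|df y| <= K) ->
  `|f x - f 0| <= K * `|x|.
Proof.
move=> d h.
have cf a b : {within `[a, b], continuous f}.
  by apply: derivable_within_continuous => y _; have ? := d y; exact: ex_derive.
have [x0|x0] := leP 0 x.
  have [c cI ->] := @MVT_segment _ f df 0 x x0 (fun y _ => d y) (cf _ _).
  move: cI; rewrite in_itv /= => /andP[c1 c2].
  by rewrite subr0 normrM ler_wpM2r // h // !ger0_norm.
have [c cI e] := @MVT_segment _ f df x 0 (ltW x0) (fun y _ => d y) (cf _ _).
move: cI; rewrite in_itv /= => /andP[c1 c2].
rewrite distrC e sub0r normrM normrN ler_wpM2r // h //.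
by rewrite !ler0_norm ?lerN2 // ltW.
Qed.

Lemma norm_sin_le (R : realType) (x : R) : `|sin x| <= `|x|.
Proof.
have := @ler_norm_derive _ sin cos x 1 (@is_derive_sin R) (fun y _ => norm_cos_le1 y).
by rewrite sin0 subr0 mul1r.
Qed.

Lemma norm_cosB1_le (R : realType) (x : R) : `|cos x - 1| <= `|x| ^+ 2.
Proof.
rewrite -[X in _ - X](@cos0 R) expr2; apply: ler_norm_derive => y h.
by rewrite normrN (le_trans (norm_sin_le _)).
Qed.

Lemma norm_sinB_le (R : realType) (x : R) : `|x| <= 1 -> `|sin x - x| <= `|x| ^+ 2.
Proof.
move=> x1; have -> : sin x - x = (sin x - x) - (sin 0 - 0) by rewrite sin0 !subr0.
apply: (@le_trans _ _ (`|x| ^+ 2 * `|x|)); last by rewrite ler_piMr // exprn_ge0.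
apply: (@ler_norm_derive _ (fun y => sin y - y) (fun y => cos y - 1)) => y h.
by rewrite (le_trans (norm_cosB1_le _)) // ler_pXn2r ?nnegrE.
Qed.

Lemma norm_expRB1_le (R : realType) (x : R) : `|x| <= 1 ->
  `|expR x - 1| <= expR 1 * `|x|.
Proof.
move=> x1; rewrite -[X in _ - X](@expR0 R).
apply: (@ler_norm_derive _ expR expR) => y h.
by rewrite ger0_norm ?expR_ge0 // ler_expR (le_trans (ler_norm y)) // (le_trans h).
Qed.

Lemma norm_expRB1B_le (R : realType) (x : R) : `|x| <= 1 ->
  `|expR x - 1 - x| <= expR 1 * `|x| ^+ 2.
Proof.
move=> x1.
have -> : expR x - 1 - x = (expR x - x) - (expR 0 - 0) by rewrite expR0; ring.
rewrite expr2 mulrA; apply: (@ler_norm_derive _ (fun y => expR y - y)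
  (fun y => expR y - 1)) => y h.
rewrite (le_trans (norm_expRB1_le _)) ?(le_trans h) //.
by rewrite ler_wpM2l ?expR_ge0.
Qed.

(** The real and imaginary parts are estimated separately from the expansions of the real
    exponential, sine and cosine at 0; each contributes at most 2 e |z|^2. *)
Lemma norm_Cexp_taylor (R : realType) (z : R[i]) : `|z| <= 1 ->
  `|Cexp z - 1 - z| <= (4 * expR 1)%:C * `|z| ^+ 2.
Proof.
move=> z1; have [r rE] : exists r : R, `|z| = r%:C by rewrite normc_def; eexists.
have r0 : 0 <= r by rewrite -ler0c -rE.
move: z1; rewrite rE -[1]/(1%:C) lecR => r1.
have [] := @norm_ReIm_le _ z r; first by rewrite rE.
case: z rE => a b rE /= ha hb.
have a1 : `|a| <= 1 by apply: le_trans r1.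
have b1 : `|b| <= 1 by apply: le_trans r1.
have E1 : 1 <= expR 1 :> R by rewrite -[X in X <= _]expR0 ler_expR ler01.
have sq (y : R) : `|y| <= r -> `|y| ^+ 2 <= r ^+ 2 by move=> hy; rewrite ler_pXn2r ?nnegrE.
have r20 : 0 <= r ^+ 2 by rewrite exprn_ge0.
rewrite -rmorphXn -rmorphM.
have -> : 4 * expR 1 * r ^+ 2 = (2 * expR 1 * r ^+ 2) + (2 * expR 1 * r ^+ 2) by ring.
have e2 : 2 * expR 1 * r ^+ 2 = expR 1 * r ^+ 2 + expR 1 * r ^+ 2 by ring.
have h1 : expR a <= expR 1 by rewrite ler_expR (le_trans (ler_norm a)).
apply: norm_complex_le; rewrite /Cexp /= !(mul0r, subr0, addr0).
  have -> : expR a * cos b - 1 - a = (expR a - 1 - a) + expR a * (cos b - 1) by ring.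
  apply: le_trans (ler_normD _ _) _; rewrite e2; apply: lerD.
    by rewrite (le_trans (norm_expRB1B_le a1)) // ler_wpM2l ?expR_ge0 // sq.
  rewrite normrM (ger0_norm (expR_ge0 _)); apply: ler_pM; rewrite ?expR_ge0 //.
  by rewrite (le_trans (norm_cosB1_le b)) // sq.
rewrite [X in `|X|](_ : _ = (expR a - 1) * sin b + (sin b - b)); last by ring.
apply: le_trans (ler_normD _ _) _; rewrite e2; apply: lerD.
  rewrite normrM expr2 mulrA; apply: ler_pM => //.
    by rewrite (le_trans (norm_expRB1_le a1)) // ler_wpM2l ?expR_ge0.
  by rewrite (le_trans (norm_sin_le b)).
rewrite (le_trans (norm_sinB_le b1)) // (le_trans (sq b hb)) //.
by rewrite ler_peMl.
Qed.

(** The functional equation reduces the difference quotient at z to the one at 0, where the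
    quadratic remainder of the exponential gives the limit b e^{bz}. *)
Lemma derivable_Cexp_scale (R : realType) (b z : R[i]) :
  derivable ((fun w => Cexp (b * w)) : R[i]^o -> R[i]^o) z 1.
Proof.
apply/cvg_ex; exists (Cexp (b * z) * b : R[i]^o).
(* The summand 1 keeps [K] positive when b = 0. *)
pose K : R[i] := `|Cexp (b * z)| * ((4 * expR 1)%:C * `|b| ^+ 2) + 1.
have K0 : 0 < K.
  rewrite ltr_wpDl ?ltr01 // !mulr_ge0 ?exprn_ge0 // ler0c.
  by rewrite mulr_ge0 ?expR_ge0.
apply/cvgrPdist_le => e e0; near=> h.
have hn0 : h != 0 by near: h; exact: nbhs_dnbhs_neq.
have hb : `|b * h| <= 1.
  have h1 : `|h| <= (`|b| + 1)^-1.
    by near: h; apply: dnbhs0_le; rewrite invr_gt0 ltr_wpDl.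
  rewrite normrM; apply: (@le_trans _ _ (`|b| * (`|b| + 1)^-1)); first by rewrite ler_wpM2l.
  by rewrite ler_pdivrMr ?ltr_wpDl // mul1r lerDl.
have he : `|h| <= e / K by near: h; apply: dnbhs0_le; rewrite divr_gt0.
have -> : Cexp (b * z) * b - h^-1 *: (Cexp (b * (h *: 1 + z)) - Cexp (b * z)) =
   - (Cexp (b * z) * ((Cexp (b * h) - 1 - b * h) / h)).
  rewrite /GRing.scale /= mulr1 (mulrDr b) CexpD.
  by field.
rewrite normrN (normrM (Cexp _)) (normrM (Cexp _ - 1 - _)) normfV.
have h0 : 0 < `|h| by rewrite normr_gt0.
have T := norm_Cexp_taylor hb.
apply: (@le_trans _ _ (K * `|h|)); last by rewrite mulrC -ler_pdivlMr.
rewrite /K mulrDl -[X in X <= _]addr0; apply: lerD; last by rewrite mul1r.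
rewrite -[X in _ <= X]mulrA. apply: ler_wpM2l => //.
rewrite ler_pdivrMr // (le_trans T) // normrM exprMn [`|h| ^+ 2]expr2 !mulrA.
exact: lexx.
Unshelve. all: end_near. Qed.

(** * Complex Laplace integrals of U *)

Lemma EulerGammaE (R : realType) (a : R) : 1 < a ->
  EulerGamma a = laplace_int (a - 1) 1 0 0.
Proof.
move=> a1; have a10 : 0 < a - 1 by rewrite subr_gt0.
have i := @laplace_kernel_integrable R (a - 1) 1 0 0 a10 ltr01.
rewrite /laplace_int -Rintegral_itv_obnd_cbnd; last first.
  apply: (integrableS _ _ _ i) => //.
  by move=> t /=; rewrite !in_itv/= !andbT => /ltW.
apply: eq_Rintegral => t _.
by rewrite /laplace_kernel mul0r addr0 cos0 mulr1 mul1r.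
Qed.

Lemma EulerGammaD1 (R : realType) (a : R) : 1 < a ->
  EulerGamma (a + 1) = a * EulerGamma a.
Proof.
move=> a1; rewrite !EulerGammaE ?ltr_wpDr // addrK.
by rewrite laplace_int_by_parts // mul1r mul0r subr0.
Qed.

(** On [1, +oo) the integrand is at least e^{-t}, whose integral there is e^{-1}. *)
Lemma EulerGamma_gt0 (R : realType) (a : R) : 1 < a -> 0 < EulerGamma a.
Proof.
move=> a1; rewrite EulerGammaE //; have a10 : 0 < a - 1 by rewrite subr_gt0.
have i := @laplace_kernel_integrable R (a - 1) 1 0 0 a10 ltr01.
have lkE t : laplace_kernel (a - 1) 1 0 0 t = t `^ (a - 1) * expR (- t) :> R.
  by rewrite /laplace_kernel mul0r addr0 cos0 mulr1 mul1r.
have lk0 (t : R) : 0 <= laplace_kernel (a - 1) 1 0 0 t.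
  by rewrite lkE mulr_ge0 ?powR_ge0 ?expR_ge0.
have cE : continuous (fun t : R => expR (- t)).
  by move=> t; apply: continuous_comp; [apply: cvgN; exact: cvg_id
    | exact: continuous_expR].
have h : (\int[@lebesgue_measure R]_(t in `[1%R, +oo[) (expR (- t))%:E = (expR (- 1))%:E)%E.
  rewrite (@ge0_continuous_FTC2y _ _ (fun t => - expR (- t)) 1 0).
  - by rewrite sub0e -EFinN opprK.
  - by move=> t _; exact: expR_ge0.
  - exact: continuous_subspaceT.
  - by rewrite -[X in _ --> X]oppr0; apply: cvgN; exact: cvgr_expR.
  - by move=> t _; apply: ex_derive.
  - by apply: cvg_at_right_filter; apply: cvgN; exact: cE.
  - by move=> t _; rewrite derive1E derive_val /= /GRing.scale /=; ring.
apply: (@lt_le_trans _ _ (expR (- 1))); first exact: expR_gt0.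
rewrite -lee_fin -h /laplace_int /Rintegral fineK; last exact: integrable_fin_num.
have sub : (`[1, +oo[%classic : set R) `<=` `[0, +oo[%classic.
  by move=> t /=; rewrite !in_itv/= !andbT; exact: le_trans ler01.
apply: (@le_trans _ _ (\int[@lebesgue_measure R]_(t in `[1%R, +oo[)
    (laplace_kernel (a - 1) 1 0 0 t)%:E)%E); last first.
  apply: ge0_subset_integral => //; first exact: (measurable_int (@lebesgue_measure R)).
  by move=> t _; rewrite lee_fin.
have m1 : measurable_fun (`[1, +oo[%classic : set R) (fun t => (expR (- t))%:E).
  by apply/measurable_EFinP; apply: measurable_funTS; exact: continuous_measurable_fun.
have m2 : measurable_fun (`[1, +oo[%classic : set R)
    (fun t => (laplace_kernel (a - 1) 1 0 0 t)%:E).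
  by apply: (measurable_int (@lebesgue_measure R)); exact: integrableS i.
have le12 (t : R) : (`[1, +oo[%classic : set R) t ->
    ((expR (- t))%:E <= (laplace_kernel (a - 1) 1 0 0 t)%:E)%E.
  rewrite /= in_itv/= andbT => t1; rewrite lee_fin lkE.
  by rewrite ler_peMl ?expR_ge0 // -[X in X <= _](powRr0 t) ler_powR // ltW.
by apply: ge0_le_integral => // t _; rewrite lee_fin ?expR_ge0.
Qed.

(** A division-free form of Gamma(l+g) / Gamma(n+g) = (g)_l / (g)_n. Since g may be negative, the
    comparison starts at an n where Euler's integral converges. *)
Lemma EulerGamma_pochhammer (R : realType) (g : R) (n l : nat) :
  1 < n%:R + g -> (n <= l)%N ->
  EulerGamma (l%:R + g) * pochhammer g n = EulerGamma (n%:R + g) * pochhammer g l.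
Proof.
move=> n1; elim: l => [|l IH]; first by rewrite leqn0 => /eqP ->.
rewrite leq_eqVlt => /predU1P[->//|]; rewrite ltnS => nl.
have l1 : 1 < l%:R + g by apply: lt_le_trans n1 _; rewrite lerD2r ler_nat.
rewrite -natr1 addrAC EulerGammaD1 // -mulrA IH //.
by rewrite [in RHS]/pochhammer big_ord_recr /= -/(pochhammer g l); ring.
Qed.

(** The real and imaginary parts of the integrand are kernels of phase 0 and pi/2, so
    [laplace_int_polar] evaluates both; the value is Gamma(a) z^{-a} at z = e^zeta. *)
Lemma is_Cintegral_laplace (R : realType) (a : R) (zeta : R[i]) :
  1 < a -> `|complex.Im zeta| < pi / 2 ->
  is_Cintegral `[0, +oo[
    (fun t => (t `^ (a - 1))%:C * Cexp (- (t%:C * Cexp zeta)))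
    ((EulerGamma a)%:C * Cexp (- (a%:C * zeta))).
Proof.
case: zeta => rho theta /= a1 ht.
have a10 : 0 < a - 1 by rewrite subr_gt0.
have c0 : 0 < expR rho * cos theta.
  rewrite mulr_gt0 ?expR_gt0 // cos_gt0_pihalf //.
  by rewrite -ltr_norml.
have ReE : (fun t => complex.Re ((t `^ (a - 1))%:C * Cexp (- (t%:C * Cexp (rho +i* theta))))) =
    laplace_kernel (a - 1) (expR rho * cos theta) (expR rho * sin theta) 0.
  apply/funext => t; rewrite /Cexp /laplace_kernel; simpc => /=.
  rewrite ?(mul0r, mulr0, subr0, addr0) cosN.
  by rewrite ![t * _]mulrC ?mulrA.
have ImE : (fun t => complex.Im ((t `^ (a - 1))%:C * Cexp (- (t%:C * Cexp (rho +i* theta))))) =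
    laplace_kernel (a - 1) (expR rho * cos theta) (expR rho * sin theta) (pi / 2).
  apply/funext => t; rewrite /Cexp /laplace_kernel cosDpihalf; simpc => /=.
  rewrite ?(mul0r, mulr0, subr0, addr0) sinN.
  by rewrite ![t * _]mulrC ?mulrA mulrN.
split.
- by have := laplace_kernel_integrable (expR rho * sin theta) 0 a10 c0; rewrite -ReE.
- by have := laplace_kernel_integrable (expR rho * sin theta) (pi / 2) a10 c0;
    rewrite -ImE.
rewrite ReE ImE.
have l0 := laplace_int_polar rho 0 a1 ht; have l1 := laplace_int_polar rho (pi / 2) a1 ht.
rewrite /laplace_int in l0 l1; rewrite l0 l1 -/(laplace_int _ _ _ _) -EulerGammaE //.
rewrite add0r [pi / 2 + _]addrC cosDpihalf /Cexp; simpc => /=.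
by rewrite ?(mul0r, mulr0, subr0, addr0) cosN sinN; congr (_ +i* _); ring.
Qed.

Lemma is_CintegralZ (R : realType) (D : set R) (f : R -> R[i]) (v : R[i]) (c : R) :
  measurable D -> is_Cintegral D f v -> is_Cintegral D (fun t => c%:C * f t) (c%:C * v).
Proof.
move=> mD [i1 i2 ->].
have ReE : (fun t => complex.Re (c%:C * f t)) = (fun t => c * complex.Re (f t)).
  by apply/funext => t; case: (f t) => x y /=; rewrite mul0r subr0.
have ImE : (fun t => complex.Im (c%:C * f t)) = (fun t => c * complex.Im (f t)).
  by apply/funext => t; case: (f t) => x y /=; rewrite mul0r addr0.
have iZ (h : R -> R) : (@lebesgue_measure R).-integrable D (fun t => (h t)%:E) ->
    (@lebesgue_measure R).-integrable D (fun t => (c * h t)%:E).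
  move=> ih; rewrite (_ : (fun t => (c * h t)%:E) = (fun t => c%:E * (h t)%:E)%E).
    exact: integrableZl.
  by apply/funext => t; rewrite EFinM.
split.
- rewrite (_ : (fun t => _) = (fun t => (c * complex.Re (f t))%:E)); first exact: iZ.
  by apply/funext => t; rewrite -[complex.Re _]/((fun t => complex.Re (c%:C * f t)) t) ReE.
- rewrite (_ : (fun t => _) = (fun t => (c * complex.Im (f t))%:E)); first exact: iZ.
  by apply/funext => t; rewrite -[complex.Im _]/((fun t => complex.Im (c%:C * f t)) t) ImE.
by rewrite ReE ImE !RintegralZl //; simpc.
Qed.

Lemma is_CintegralD (R : realType) (D : set R) (f1 f2 : R -> R[i]) (v1 v2 : R[i]) :
  measurable D -> is_Cintegral D f1 v1 -> is_Cintegral D f2 v2 ->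
  is_Cintegral D (fun t => f1 t + f2 t) (v1 + v2).
Proof.
move=> mD [i1 i2 ->] [j1 j2 ->].
have ReE t : complex.Re (f1 t + f2 t) = complex.Re (f1 t) + complex.Re (f2 t).
  by case: (f1 t) => x y; case: (f2 t).
have ImE t : complex.Im (f1 t + f2 t) = complex.Im (f1 t) + complex.Im (f2 t).
  by case: (f1 t) => x y; case: (f2 t).
split.
- rewrite (_ : (fun t => _) =
    (fun t => (complex.Re (f1 t))%:E + (complex.Re (f2 t))%:E)%E); first exact: integrableD.
  by apply/funext => t; rewrite ReE EFinD.
- rewrite (_ : (fun t => _) =
    (fun t => (complex.Im (f1 t))%:E + (complex.Im (f2 t))%:E)%E); first exact: integrableD.
  by apply/funext => t; rewrite ImE EFinD.
have -> : (fun t => complex.Re (f1 t + f2 t)) =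
    (fun t => complex.Re (f1 t) + complex.Re (f2 t)) by apply/funext.
have -> : (fun t => complex.Im (f1 t + f2 t)) =
    (fun t => complex.Im (f1 t) + complex.Im (f2 t)) by apply/funext.
by rewrite !RintegralD.
Qed.

Lemma is_Cintegral0 (R : realType) (D : set R) :
  measurable D -> is_Cintegral D (fun=> 0) 0.
Proof.
move=> mD; split; [exact: integrable0 | exact: integrable0 |].
by rewrite /Rintegral /= integral0.
Qed.

Lemma is_Cintegral_sum (R : realType) (D : set R) (N : nat) (f : nat -> R -> R[i])
    (v : nat -> R[i]) :
  measurable D -> (forall q, (q < N)%N -> is_Cintegral D (f q) (v q)) ->
  is_Cintegral D (fun t => \sum_(q < N) f q t) (\sum_(q < N) v q).
Proof.
move=> mD; elim: N => [|N IH] h.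
  rewrite big_ord0 (_ : (fun t => _) = fun=> 0); first exact: is_Cintegral0.
  by apply/funext => t; rewrite big_ord0.
rewrite big_ord_recr /= (_ : (fun t => _) = (fun t => \sum_(q < N) f q t + f N t)).
  apply: is_CintegralD => //; last exact: h.
  by apply: IH => q qN; apply: h; apply: ltnW.
by apply/funext => t; rewrite big_ord_recr.
Qed.

(** * The explicit denominator and its Laplace representation *)

Definition node_poly (R : nzRingType) (k : nat) (lam : 'I_k -> R) (m : 'I_k -> nat) : {poly R} :=
  \prod_(j < k) (1 - (lam j)%:P * 'X) ^+ m j.

(** The Pochhammer quotient stands for Gamma(n+m-q+g) / Gamma(n+m+g), and it equals 1 at q = 0, so
    the constant coefficient is 1. *)
Definition HPden (R : realType) (k : nat) (g : R) (lam : 'I_k -> R) (n : nat)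
    (m : 'I_k -> nat) : {poly R[i]} :=
  \poly_(q < (mtotal m).+1) ((node_poly lam m)`_q *
     (pochhammer g (n + mtotal m - q) / pochhammer g (n + mtotal m)))%:C.

Lemma size_node_poly (R : idomainType) (k : nat) (lam : 'I_k -> R) (m : 'I_k -> nat) :
  (forall j, lam j <> 0) -> size (node_poly lam m) = (mtotal m).+1.
Proof.
move=> h; have s1 j : size (1 - (lam j)%:P * 'X) = 2%N.
  have l0 : lam j != 0 by apply/eqP; exact: h.
  rewrite addrC size_polyDl size_polyN mul_polyC size_scale ?size_polyX //.
  by rewrite size_poly1.
have n0 j : (1 - (lam j)%:P * 'X) != 0 by rewrite -size_poly_eq0 s1.
rewrite /node_poly size_prod; last by move=> j _; rewrite expf_neq0.
rewrite (eq_bigr (fun j => (m j).+1)); last first.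
  by move=> j _; rewrite -[LHS]prednK ?lt0n ?size_poly_eq0 ?expf_neq0 // size_exp s1 mul1n.
have -> : (\sum_(j < k) (m j).+1 = mtotal m + k)%N.
  rewrite (eq_bigr (fun j => (m j + 1)%N)); last by move=> j _; rewrite addn1.
  by rewrite big_split /= sum1_card card_ord.
have -> : #|[pred _ : 'I_k | true]| = k by rewrite -[RHS]card_ord; apply: eq_card.
by rewrite -addSn addnK.
Qed.

Lemma horner_node_poly (R : comNzRingType) (k : nat) (lam : 'I_k -> R)
    (m : 'I_k -> nat) (x : R) :
  (node_poly lam m).[x] = \prod_(j < k) (1 - lam j * x) ^+ m j.
Proof.
rewrite horner_prod; apply: eq_bigr => j _.
by rewrite horner_exp !hornerE.
Qed.

(** For t > 0 the product in U is t^m times [node_poly] at 1/t; at t = 0 both sides vanish, all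
    exponents of t being positive. *)
Lemma Ugamma_expand (R : realType) (k : nat) (g : R) (lam : 'I_k -> R) (n : nat)
    (m : 'I_k -> nat) (t : R) :
  (forall j, lam j <> 0) -> 1 < n%:R + g -> 0 <= t ->
  Ugamma g lam n m t = \sum_(q < (mtotal m).+1)
    (node_poly lam m)`_q * t `^ ((n + mtotal m - q)%:R + g - 1).
Proof.
move=> hlam n1; rewrite le_eqVlt => /predU1P[<-|t0].
  rewrite /Ugamma powR0 ?mul0r; last by apply: lt0r_neq0; lra.
  rewrite big1 // => q _; rewrite powR0 ?mulr0 //; apply: lt0r_neq0.
  have : n%:R <= (n + mtotal m - q)%:R :> R.
    by rewrite ler_nat -addnBA ?leq_addr // -ltnS ltn_ord.
  by lra.
have tn0 : t != 0 by rewrite gt_eqF.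
rewrite /Ugamma.
have -> : \prod_(p < k) (t - lam p) ^+ m p = t ^+ mtotal m * (node_poly lam m).[t^-1].
  rewrite horner_node_poly /mtotal -prodrXr -big_split /=.
  by apply: eq_bigr => j _; rewrite -exprMn mulrBr mulr1 mulrCA divff // mulr1.
rewrite (@horner_coef_wide _ (mtotal m).+1); last by rewrite size_node_poly.
rewrite !mulr_sumr; apply: eq_bigr => q _.
have qm : (q <= mtotal m)%N by rewrite -ltnS.
have -> : (n + mtotal m - q)%:R + g - 1 = n%:R + g - 1 + (mtotal m - q)%:R :> R.
  by rewrite -addnBA // natrD; ring.
rewrite (@powRD _ t (n%:R + g - 1)); last by rewrite tn0 implybT.
rewrite powR_mulrn ?(ltW t0) // exprVn.
rewrite -{1}(subnK qm) exprD.
by field; rewrite expf_neq0.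
Qed.

Lemma eq_is_Cintegral (R : realType) (D : set R) (f1 f2 : R -> R[i]) (v : R[i]) :
  measurable D -> (forall t, D t -> f1 t = f2 t) -> is_Cintegral D f1 v -> is_Cintegral D f2 v.
Proof.
move=> mD h [i1 i2 ->]; split.
- by apply: eq_integrable i1 => // t; rewrite inE => /h ->.
- by apply: eq_integrable i2 => // t; rewrite inE => /h ->.
- by congr (_ +i* _); apply: eq_Rintegral => t; rewrite inE => /h ->.
Qed.

Lemma pochhammer_neq0 (R : realType) (g : R) (l : nat) :
  (forall p : nat, g <> - p%:R) -> pochhammer g l != 0.
Proof.
move=> hg; apply/prodf_neq0 => i _; apply/eqP => e; apply: (hg i).
by rewrite -[g](addrK i%:R) e sub0r.
Qed.

(** The Laplace integral of each power of t in the expansion of U is replaced by Gamma(a) e^{-a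
    zeta}, which is entire in zeta. *)
Definition laplace_ext (R : realType) (k : nat) (g : R) (lam : 'I_k -> R) (n : nat)
    (m : 'I_k -> nat) (zeta : R[i]) : R[i] :=
  \sum_(q < (mtotal m).+1) ((node_poly lam m)`_q)%:C *
   ((EulerGamma ((n + mtotal m - q)%:R + g))%:C *
     Cexp (- (((n + mtotal m - q)%:R + g)%:C * zeta))).

(** With N = n + m, factor out the term q = 0: the Gamma values have Pochhammer quotients, and
    e^{-(N-q+g) zeta} is e^{-(N+g) zeta} times the q-th power of e^zeta. *)
Lemma laplace_extE (R : realType) (k : nat) (g : R) (lam : 'I_k -> R) (n : nat)
    (m : 'I_k -> nat) (zeta : R[i]) :
  (forall p : nat, g <> - p%:R) -> 1 < n%:R + g ->
  laplace_ext g lam n m zeta =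
  (EulerGamma ((n + mtotal m)%:R + g))%:C * Cexp (- (((n + mtotal m)%:R + g)%:C * zeta))
    * (HPden g lam n m).[Cexp zeta].
Proof.
move=> hg n1; rewrite horner_poly mulr_sumr; apply: eq_bigr => q _.
have qm : (q <= mtotal m)%N by rewrite -ltnS.
set N := (n + mtotal m)%N.
have nN : (n <= N - q)%N by rewrite /N -addnBA // leq_addr.
have NqE : N = (N - q + q)%N by rewrite subnK // /N (leq_trans qm) ?leq_addl.
have -> : EulerGamma ((N - q)%:R + g) = EulerGamma (N%:R + g) *
    (pochhammer g (N - q) / pochhammer g N).
  have p0 := pochhammer_neq0 n hg; have pN := pochhammer_neq0 N hg.
  have e1 := EulerGamma_pochhammer n1 nN.
  have e2 := EulerGamma_pochhammer n1 (leq_trans nN (leq_subr q N)).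
  by apply: (mulIf p0); rewrite e1 mulrAC e2; field.
have -> : Cexp (- (((N - q)%:R + g)%:C * zeta)) =
    Cexp (- ((N%:R + g)%:C * zeta)) * Cexp zeta ^+ q.
  have -> : Cexp zeta ^+ q = Cexp (q%:R * zeta).
    elim: (q : nat) => [|i IH]; first by rewrite mul0r Cexp0.
    by rewrite exprS IH -CexpD -natr1; congr Cexp; ring.
  rewrite -CexpD; congr Cexp; rewrite [in RHS]NqE natrD !rmorphD /= !rmorph_nat.
  by ring.
by rewrite !rmorphM /=; ring.
Qed.

Lemma laplace_continuation_ext (R : realType) (k : nat) (g : R) (lam : 'I_k -> R)
    (n : nat) (m : 'I_k -> nat) :
  (forall j, lam j <> 0) -> 1 < n%:R + g ->
  laplace_continuation (Ugamma g lam n m) (laplace_ext g lam n m).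
Proof.
move=> hlam n1; split=> [zeta|zeta hz].
  rewrite (_ : laplace_ext g lam n m = \sum_(q < (mtotal m).+1)
    (((node_poly lam m)`_q)%:C * (EulerGamma ((n + mtotal m - q)%:R + g))%:C : R[i]) \*:
      ((fun w => Cexp (- ((n + mtotal m - q)%:R + g)%:C * w)) : R[i]^o -> R[i]^o)).
    apply: derivable_sum => q; apply: derivableZ; exact: derivable_Cexp_scale.
  apply/funext => w; rewrite fct_sumE; apply: eq_bigr => q _.
  by rewrite /GRing.scale /= mulrA mulNr.
have mD : measurable (`[0, +oo[%classic : set R) by exact: measurable_itv.
pose h (q : nat) (t : R) : R[i] := ((node_poly lam m)`_q)%:C *
  ((t `^ ((n + mtotal m - q)%:R + g - 1))%:C * Cexp (- (t%:C * Cexp zeta))).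
apply: (@eq_is_Cintegral _ _ (fun t => \sum_(q < (mtotal m).+1) h q t)) => //.
  move=> t /=; rewrite in_itv/= andbT => t0.
  rewrite Ugamma_expand // rmorph_sum mulr_suml; apply: eq_bigr => q _.
  by rewrite /h rmorphM /= mulrA.
apply: (is_Cintegral_sum (v := fun q => ((node_poly lam m)`_q)%:C *
   ((EulerGamma ((n + mtotal m - q)%:R + g))%:C *
     Cexp (- (((n + mtotal m - q)%:R + g)%:C * zeta))))) => // q qm.
apply: is_CintegralZ => //; apply: is_Cintegral_laplace => //.
apply: lt_le_trans n1 _; rewrite lerD2r ler_nat -addnBA // leq_addr //.
Qed.

(** At zeta = ix the factor e^{-(N+g) zeta} has modulus 1, which leaves Gamma(N+g) times the modulus
    of the denominator at e^{ix}. *)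
Lemma norm_laplace_ext (R : realType) (k : nat) (g : R) (lam : 'I_k -> R) (n : nat)
    (m : 'I_k -> nat) (x : R) :
  (forall p : nat, g <> - p%:R) -> 1 < n%:R + g ->
  (1 / EulerGamma ((n + mtotal m)%:R + g) ^+ 2)%:C * `|laplace_ext g lam n m (0 +i* x)| ^+ 2
    = `|(HPden g lam n m).[cis x]| ^+ 2.
Proof.
move=> hg n1; rewrite laplace_extE // -cisE.
have N1 : 1 < (n + mtotal m)%:R + g.
  by apply: lt_le_trans n1 _; rewrite lerD2r ler_nat leq_addr.
have G0 := EulerGamma_gt0 N1.
rewrite (normrM (_ * Cexp _)) (normrM _%:C) norm_Cexp norm_real_complex (gtr0_norm G0).
rewrite [complex.Re _](_ : _ = 0); last by simpc; rewrite ?mulr0 ?oppr0.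
rewrite expR0 mulr1 exprMn mulrA -rmorphXn -rmorphM /=.
by rewrite mul1r mulVf ?expf_neq0 ?gt_eqF // mul1r.
Qed.

Lemma is_Cintegral_HPden (R : realType) (k : nat) (g : R) (lam : 'I_k -> R) (n : nat)
    (m : 'I_k -> nat) (x : R) :
  (forall j, lam j <> 0) -> (forall p : nat, g <> - p%:R) -> 1 < n%:R + g -> 0 < cos x ->
  exists2 I : R[i],
    is_Cintegral `[0, +oo[
      (fun t => (Ugamma g lam n m t)%:C * Cexp (- (t%:C * (cos x +i* sin x)))) I &
    (1 / EulerGamma ((n + mtotal m)%:R + g) ^+ 2)%:C * `|I| ^+ 2
      = `|(HPden g lam n m).[cis x]| ^+ 2.
Proof.
(* The point e^{ix} determines x only modulo 2 pi; as cos x > 0, [y] is a representative in (-pi/2,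
   pi/2), the strip where the integral is known. *)
move=> hlam hg n1 x0; pose y := asin (sin x).
have s1 : -1 <= sin x <= 1 by rewrite sin_geN1 sin_le1.
have sy : sin y = sin x by rewrite asinK // in_itv.
have cy : cos y = cos x.
  rewrite cos_asin // -[RHS]ger0_norm ?(ltW x0) // -sqrtr_sqr.
  by congr Num.sqrt; rewrite -(cos2Dsin2 x) addrK.
have xy : cis x = cis y by rewrite /cis cy sy.
have s1' : -1 < sin x < 1.
  rewrite -ltr_norml -(ltr_pXn2r (_ : 0 < 2)%N) ?nnegrE // expr1n real_normK ?num_real //.
  have := cos2Dsin2 x; have : 0 < cos x ^+ 2 by rewrite exprn_gt0.
  by lra.
have hy : `|complex.Im (0 +i* y)| < pi / 2.
  move: s1' => /andP[h1 h2]; rewrite /= ltr_norml asin_ltpi2 ?asin_gtNpi2 //.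
    by rewrite h1 ltW.
  by rewrite h2 ltW.
exists (laplace_ext g lam n m (0 +i* y)); last by rewrite norm_laplace_ext // xy.
have [_ /(_ _ hy)] := laplace_continuation_ext m hlam n1.
by rewrite -cisE -xy.
Qed.

(** * Hermite--Pade denominators *)

(** The operator b - z d/dz, which multiplies z^q by b - q. *)
Definition euler_op (F : fieldType) (b : F) (p : {poly F}) : {poly F} :=
  b%:P * p - 'X * p^`().

(** Lowering b by one at each step multiplies z^q by a falling factorial of b - q, which is a
    quotient of Pochhammer symbols when b = g + N - 1. *)
Fixpoint euler_iter (F : fieldType) (b : F) (i : nat) (p : {poly F}) : {poly F} :=
  if i is i'.+1 then euler_op (b - i'%:R) (euler_iter b i' p) else p.

Lemma coef_euler_iter (F : fieldType) (b : F) (i : nat) (p : {poly F}) (q : nat) :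
  (euler_iter b i p)`_q = (\prod_(t < i) (b - t%:R - q%:R)) * p`_q.
Proof.
elim: i => [|i IH] /=; first by rewrite big_ord0 mul1r.
rewrite /euler_op coefB coefCM coefXM coef_deriv big_ord_recr /= mulrAC -IH.
case: q IH => [|q] _ /=; first by rewrite !subr0 mulrC.
by rewrite -[_ *+ _]mulr_natl; ring.
Qed.

(** One step on d (X - y)^{s+1} multiplies the value of the cofactor at y by -(s+1) y, which is
    nonzero; the order of vanishing at y thus drops by exactly one while it is positive. *)
Lemma euler_iter_XsubC (F : numFieldType) (b y : F) (c : {poly F}) (r i : nat) :
  y != 0 -> (i <= r)%N ->
  exists d : {poly F}, exists2 k : F, k != 0 &
    euler_iter b i (c * ('X - y%:P) ^+ r) = d * ('X - y%:P) ^+ (r - i) /\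
    d.[y] = k * c.[y].
Proof.
move=> y0; elim: i => [|i IH] ir.
  by exists c; exists 1; rewrite ?oner_neq0 // subn0 mul1r.
have [d [k k0 [e dk]]] := IH (ltnW ir); move: e.
have -> : (r - i = (r - i.+1).+1)%N by rewrite subnSK.
move=> e; set s := (r - i.+1)%N; set b' := b - i%:R.
exists (b'%:P * d * ('X - y%:P) - 'X * d^`() * ('X - y%:P) - s.+1%:R%:P * 'X * d).
exists (- (s.+1%:R * y * k)); first by rewrite oppr_eq0 !mulf_neq0 // pnatr_eq0.
split; last by rewrite !hornerE subrr dk !mulr0; ring.
rewrite /= e /euler_op -/b' derivM deriv_exp derivXsubC /=.
by rewrite exprS -[_ *+ _]mulr_natl (rmorph_nat (@polyC F)) -/s; ring.
Qed.

(** The iterates serve as Taylor coefficients at y: if p = c (X - y)^r, the r-th iterate at y is a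
    nonzero multiple of c(y), so its vanishing yields one more factor. *)
Lemma euler_iter_roots (F : numFieldType) (b y : F) (p : {poly F}) (r : nat) :
  y != 0 ->
  (('X - y%:P) ^+ r %| p) <-> (forall i, (i < r)%N -> (euler_iter b i p).[y] = 0).
Proof.
move=> y0; split.
  move=> /dvdpP[c ->] i ir; have [d [k _ [-> _]]] := euler_iter_XsubC b c y0 (ltnW ir).
  by rewrite hornerM horner_exp hornerXsubC subrr -subnSK // exprS mul0r mulr0.
elim: r => [|r IH] h; first by rewrite expr0 dvd1p.
have /dvdpP[c pE] : ('X - y%:P) ^+ r %| p by apply: IH => i ir; apply: h; apply: ltnW.
have := h r (ltnSn r); have [d [k k0 [e dk]]] := euler_iter_XsubC b c y0 (leqnn r).
rewrite pE e subnn expr0 mulr1 dk => /eqP; rewrite mulf_eq0 (negPf k0) /= => c0.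
have /dvdpP[c' ->] : 'X - y%:P %| c by rewrite dvdp_XsubCl.
by rewrite -mulrA -exprS dvdp_mull.
Qed.

Lemma prod_XsubC_exp_dvdp (F : fieldType) (k : nat) (y : 'I_k -> F) (m : 'I_k -> nat)
    (p : {poly F}) :
  injective y -> (forall j, ('X - (y j)%:P) ^+ m j %| p) ->
  \prod_(j < k) ('X - (y j)%:P) ^+ m j %| p.
Proof.
move=> yI h.
have : uniq (index_enum 'I_k) by exact: index_enum_uniq.
elim: (index_enum _) => [|j s IH] /=; first by rewrite big_nil dvd1p.
move=> /andP[js us]; rewrite big_cons Gauss_dvdp ?h ?IH //.
apply: coprimep_expl; rewrite coprimep_sym coprimep_XsubC rootE horner_prod.
rewrite prodf_seq_neq0; apply/allP => i si /=.
rewrite horner_exp expf_neq0 // hornerXsubC subr_eq0; apply/eqP => /yI e.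
by move: js; rewrite e si.
Qed.

Lemma node_polyE (F : fieldType) (k : nat) (lam : 'I_k -> F) (m : 'I_k -> nat) :
  (forall j, lam j != 0) ->
  exists2 c : F, c != 0 &
    node_poly lam m = c *: \prod_(j < k) ('X - ((lam j)^-1)%:P) ^+ m j.
Proof.
move=> h; exists (\prod_(j < k) (- lam j) ^+ m j).
  by apply/prodf_neq0 => j _; rewrite expf_neq0 // oppr_eq0.
rewrite -mul_polyC rmorph_prod -big_split; apply: eq_bigr => j _ /=.
rewrite rmorphXn -exprMn /= mulrBr -polyCM mulNr divff // !polyCN polyC1; congr (_ ^+ _).
by ring.
Qed.

Lemma map_node_poly (R : realType) (k : nat) (lam : 'I_k -> R) (m : 'I_k -> nat) (q : nat) :
  (node_poly (fun j => (lam j)%:C) m)`_q = ((node_poly lam m)`_q)%:C.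
Proof.
have -> : node_poly (fun j => (lam j)%:C) m = map_poly (real_complex R) (node_poly lam m).
  rewrite /node_poly rmorph_prod; apply: eq_bigr => j _.
  by rewrite rmorphXn rmorphB rmorph1 rmorphM /= map_polyC map_polyX.
by rewrite coef_map.
Qed.

(* Rescaled coefficients, for which the Hermite--Pade conditions at the order
   [n + m - i] say that [euler_iter _ i] vanishes at [1 / lam j]. *)
Definition rescale (R : realType) (g : R) (N M : nat) (Q : {poly R[i]}) : {poly R[i]} :=
  \poly_(q < M.+1) (Q`_q * (pochhammer g N / pochhammer g (N - q))%:C).

Lemma pochhammer_falling (R : realType) (g : R) (l i : nat) :
  pochhammer g (l + i) =
  pochhammer g l * \prod_(t < i) (g + (l + i)%:R - 1 - t%:R).
Proof.
elim: i => [|i IH]; first by rewrite addn0 big_ord0 mulr1.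
rewrite addnS {1}/pochhammer big_ord_recr /= -/(pochhammer g _) IH big_ord_recl /=.
rewrite -natr1 subr0 -!mulrA; congr (_ * _); rewrite mulrC; congr (_ * _); first by ring.
by apply: eq_bigr => t _; rewrite /bump /= add1n -(natr1 t); ring.
Qed.

Lemma sum_coef_widen (F : nzRingType) (Q : {poly F}) (M L : nat) (f : nat -> F) :
  (size Q <= M.+1)%N -> (M <= L)%N ->
  \sum_(q < L.+1) Q`_q * f q = \sum_(q < M.+1) Q`_q * f q.
Proof.
move=> sQ ML; rewrite (big_ord_widen _ (fun q => Q`_q * f q) (ML : (M.+1 <= L.+1)%N)).
rewrite [RHS]big_mkcond; apply: eq_bigr => q _; case: ltnP => // qM.
by rewrite nth_default ?mul0r // (leq_trans sQ).
Qed.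

(** Write N = n + M and split 1/(g)_{N-i-q} as (g)_{N-q}/(g)_{N-i-q} times 1/(g)_{N-q}: [euler_iter]
    produces the first factor and [rescale] absorbs the second. As i <= n, the sum reaches all
    coefficients of Q. *)
Lemma HP_sumE (R : realType) (g lam : R) (n M i : nat) (Q : {poly R[i]}) :
  (forall p : nat, g <> - p%:R) -> lam != 0 -> (size Q <= M.+1)%N -> (i <= n)%N ->
  \sum_(q < (n + M - i).+1) Q`_q * Ecoef g lam (n + M - i - q) =
  (lam ^+ (n + M - i) / pochhammer g (n + M))%:C *
    (euler_iter (g + (n + M)%:R - 1)%:C i (rescale g (n + M) M Q)).[(lam^-1)%:C].
Proof.
move=> hg l0 sQ iN.
have Mi : (M <= n + M - i)%N by rewrite addnC -addnBA // leq_addr.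
rewrite (sum_coef_widen (fun q => Ecoef g lam (n + M - i - q)) sQ Mi).
have sP : (size (euler_iter (g + (n + M)%:R - 1)%:C i (rescale g (n + M) M Q)) <= M.+1)%N.
  apply/leq_sizeP => j Mj; rewrite coef_euler_iter nth_default ?mulr0 //.
  by rewrite (leq_trans _ Mj) // size_poly.
rewrite (horner_coef_wide _ sP) mulr_sumr; apply: eq_bigr => q _.
have qM : (q <= M)%N by rewrite -ltnS.
rewrite coef_euler_iter coef_poly ltn_ord.
have e : (n + M - q = n + M - i - q + i)%N by lia.
have p1 := pochhammer_neq0 (n + M) hg; have p2 := pochhammer_neq0 (n + M - i - q) hg.
have p3 := pochhammer_neq0 (n + M - q) hg.
have -> : \prod_(t < i) ((g + (n + M)%:R - 1)%:C - t%:R - q%:R) =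
    (pochhammer g (n + M - q) / pochhammer g (n + M - i - q))%:C.
  rewrite e pochhammer_falling -e mulrAC divff // mul1r rmorph_prod; apply: eq_bigr => t _.
  rewrite -[t%:R](rmorph_nat (real_complex R)) -[q%:R](rmorph_nat (real_complex R)).
  by rewrite -!rmorphB natrB; [congr (_%:C); ring | lia].
rewrite /Ecoef.
have -> : lam ^+ (n + M - i) = lam ^+ (n + M - i - q) * lam ^+ q by rewrite -exprD; congr (_ ^+ _); lia.
set l1 := lam ^+ (n + M - i - q); set a := pochhammer g (n + M); set b := pochhammer g (n + M - i - q).
set c := pochhammer g (n + M - q).
have e2 : l1 / b = (l1 * lam ^+ q / a) * (c / b) * (a / c) * lam^-1 ^+ q.
  by rewrite exprVn /a /b /c; field; rewrite p1 p2 p3 expf_neq0.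
rewrite [in LHS](_ : l1 / _ = (l1 * lam ^+ q / a) * (c / b) * (a / c) * lam^-1 ^+ q) //.
rewrite !rmorphM !rmorphXn /=. ring.
Qed.

Lemma rescale_HPden (R : realType) (k : nat) (g : R) (lam : 'I_k -> R) (n : nat)
    (m : 'I_k -> nat) :
  (forall p : nat, g <> - p%:R) -> (forall j, lam j <> 0) ->
  rescale g (n + mtotal m) (mtotal m) (HPden g lam n m) = node_poly (fun j => (lam j)%:C) m.
Proof.
move=> hg hlam; apply/polyP => q; rewrite !coef_poly.
have hl j : (lam j)%:C <> 0 by move=> /complexI /hlam.
case: ltnP => qM; last by rewrite nth_default // size_node_poly.
have p1 := pochhammer_neq0 (n + mtotal m) hg; have p2 := pochhammer_neq0 (n + mtotal m - q) hg.
by rewrite map_node_poly -rmorphM; congr (_%:C) => /=; field; rewrite p1 p2.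
Qed.

(** The conditions at the orders N - i, i < m_j, where P_j has no coefficient, mean that (X -
    1/lam_j)^{m_j} divides the rescaled polynomial. Hence [node_poly] divides it; its degree m is
    the largest allowed, so the two are proportional and the value at 0 fixes the factor. *)
Lemma HPden_HP (R : realType) (k : nat) (g : R) (lam : 'I_k -> R) (n : nat)
    (m : 'I_k -> nat) :
  (forall p : nat, g <> - p%:R) -> injective lam -> (forall j, lam j <> 0) ->
  (forall j, (m j <= n)%N) ->
  unique (HP_denominator_normalized (fun j => Ecoef g (lam j)) n m) (HPden g lam n m).
Proof.
move=> hg lamI hlam mn; set Q := HPden _ _ _ _; set M := mtotal m; set N := (n + M)%N.
have l0 j : lam j != 0 by apply/eqP; exact: hlam.
have l0C j : (lam j)%:C != 0 :> R[i] by apply/eqP => /complexI; exact: hlam.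
have v0C j : ((lam j)^-1)%:C != 0 :> R[i] by rewrite fmorph_eq0 invr_eq0.
have hlC j : (lam j)%:C <> 0 :> R[i] by apply/eqP.
have mM j : (m j <= M)%N by rewrite /M /mtotal (bigD1 j) //= leq_addr.
have [c c0 nodeE] := node_polyE m l0C.
have vE j : (lam j)%:C^-1 = ((lam j)^-1)%:C :> R[i] by rewrite fmorphV.
have pN := pochhammer_neq0 N hg.
have node0 : (node_poly lam m)`_0 = 1.
  rewrite -horner_coef0 horner_node_poly big1 // => j _.
  by rewrite mulr0 subr0 expr1n.
have Q00 : Q`_0 = 1.
  by rewrite coef_poly ltn0Sn /= node0 mul1r subn0 divff.
have sQ : (size Q <= M.+1)%N by exact: size_poly.
split.
  split; last by rewrite horner_coef0.
  split => //; first by apply/eqP => Q0; move: Q00; rewrite Q0 coef0 => /eqP; rewrite eq_sym oner_eq0.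
  exists (fun j => \poly_(l < (ndeg n m j).+1)
    \sum_(q < l.+1) Q`_q * Ecoef g (lam j) (l - q)) => j.
  split=> [|l lN]; first exact: size_poly.
  rewrite coef_poly ltnS; case: leqP => // nl.
  have iE : (l = n + M - (N - l))%N by rewrite subKn.
  have im : (N - l < m j)%N by have := mM j; rewrite /ndeg in nl; rewrite /N /M; lia.
  rewrite iE HP_sumE ?(leq_trans (ltnW im)) // rescale_HPden //.
  have [h _] := euler_iter_roots (g + N%:R - 1)%:C (node_poly (fun j => (lam j)%:C) m)
    (m j) (v0C j).
  rewrite h ?mulr0 // nodeE (bigD1 j) //= -vE -mul_polyC mulrCA.
  by rewrite dvdp_mulr.
move=> Q' [[Q'0 sQ' [P hP]] Q'1].
have dv : node_poly (fun j => (lam j)%:C) m %| rescale g N M Q'.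
  rewrite nodeE dvdpZl //; apply: prod_XsubC_exp_dvdp.
    by move=> i j /invr_inj /complexI /lamI.
  move=> j; rewrite vE; apply/(euler_iter_roots (g + N%:R - 1)%:C _ _ (v0C j)) => i im.
  have [sP h] := hP j; have := h (N - i)%N (leq_subr _ _).
  have -> : (P j)`_(N - i) = 0.
    rewrite nth_default // (leq_trans sP) // /ndeg -/M -/N.
    by have := mM j; have := mn j; rewrite /N; lia.
  rewrite HP_sumE ?(leq_trans (ltnW im)) // => /eqP.
  rewrite mulf_eq0 => /orP[|/eqP //].
  by rewrite fmorph_eq0 mulf_eq0 expf_eq0 (negPf (l0 j)) andbF invr_eq0 (negPf pN).
have r0 : (rescale g N M Q')`_0 = 1.
  by rewrite coef_poly ltn0Sn -horner_coef0 Q'1 mul1r subn0 divff.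
have sn : size (node_poly (fun j => (lam j)%:C : R[i]) m) = M.+1 by rewrite size_node_poly.
have rn0 : rescale g N M Q' != 0.
  by apply/eqP => e; move: r0; rewrite e coef0 => /eqP; rewrite eq_sym oner_eq0.
have /eqpP[[c1 c2] /= /andP[c10 c20] e] : node_poly (fun j => (lam j)%:C) m %= rescale g N M Q'.
  rewrite -(dvdp_size_eqp dv) eqn_leq sn size_poly andbT.
  by rewrite -sn dvdp_leq.
have c12 : c1 = c2.
  have := congr1 (fun p : {poly _} => p`_0) e; rewrite /= !coefZ r0 mulr1 map_node_poly node0.
  by rewrite mulr1.
move: e; rewrite c12 => /(scalerI c20) e; apply/polyP => q.
have := congr1 (fun p : {poly _} => p`_q) e; rewrite -(rescale_HPden n m hg hlam).
rewrite -/Q -/M -/N /rescale [X in X = _ -> _]coef_poly [X in _ = X -> _]coef_poly.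
case: ltnP => qM; last by rewrite !nth_default ?(leq_trans _ qM).
by apply: mulIf; rewrite fmorph_eq0 mulf_neq0 // invr_eq0; exact: pochhammer_neq0.
Qed.

(** * Zeros of the denominator *)

Lemma coefM_dominated (R : numDomainType) (p q P Q : {poly R}) :
  (forall i, `|p`_i| <= P`_i) -> (forall i, `|q`_i| <= Q`_i) ->
  forall i, `|(p * q)`_i| <= (P * Q)`_i.
Proof.
move=> hp hq i; rewrite !coefM; apply: le_trans (ler_norm_sum _ _ _) _.
by apply: ler_sum => j _; rewrite normrM ler_pM.
Qed.

(** The factors 1 + |lam_j| z have nonnegative coefficients, so they majorize the factors 1 - lam_j
    z, and majorization is stable under products. *)
Lemma node_poly_dominated (R : realType) (k : nat) (lam : 'I_k -> R) (m : 'I_k -> nat) i :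
  `|(node_poly lam m)`_i| <= (node_poly (fun j => - `|lam j|) m)`_i.
Proof.
rewrite /node_poly; move: i.
apply: (big_ind2 (fun p P : {poly R} => forall i, `|p`_i| <= P`_i)).
- by move=> i; rewrite coef1; case: eqP; rewrite ?normr1 ?normr0.
- by move=> p P q Q; exact: coefM_dominated.
move=> j _; elim: (m j) => [|e IH] i.
  by rewrite !expr0 coef1; case: eqP; rewrite ?normr1 ?normr0.
rewrite !exprS; apply: coefM_dominated => // {}i.
rewrite !coefB !coefCM !coefX !coef1; case: i => [|[|i]] /=.
- by rewrite !mulr0 !subr0 normr1.
- by rewrite !mulr1 !sub0r normrN opprK.
- by rewrite !mulr0 !subr0 normr0.
Qed.

Lemma norm_node_poly_le (R : realType) (k : nat) (lam : 'I_k -> R) (m : 'I_k -> nat)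
    (L x : R) (M : nat) :
  (forall j, `|lam j| <= L) -> (forall j, lam j <> 0) -> 0 <= x -> M = mtotal m ->
  \sum_(q < M.+1) `|(node_poly lam m)`_q| * x ^+ q <= expR (L * x * M%:R).
Proof.
move=> hL hlam x0 ->.
apply: (@le_trans _ _ (node_poly (fun j => - `|lam j|) m).[x]).
  rewrite (@horner_coef_wide _ (mtotal m).+1); last first.
    by rewrite size_node_poly // => j /eqP; rewrite oppr_eq0 normr_eq0 => /eqP; exact: hlam.
  by apply: ler_sum => q _; rewrite ler_wpM2r ?exprn_ge0 // node_poly_dominated.
rewrite horner_node_poly expRM_natr /mtotal -prodrXr.
apply: ler_prod => j _; rewrite mulNr opprK; apply/andP; split.
  by rewrite exprn_ge0 // addr_ge0 // mulr_ge0.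
apply: lerXn2r; rewrite ?nnegrE ?expR_ge0 ?addr_ge0 ?mulr_ge0 //.
apply: le_trans (expR_ge1Dx _); rewrite lerD2l ler_wpM2r //.
Qed.

(* [(A - 1) ... (A - q)] is compared with [A ^ q]; [K] bounds the ratios
   [A / (A - i)]. *)
Lemma prod_shift_bound (R : realType) (A K : R) (q : nat) :
  1 <= K -> 0 < A -> (forall i, (i < q)%N -> 0 < A - 1 - i%:R /\ A <= K * (A - 1 - i%:R)) ->
  0 <= A ^+ q * \prod_(i < q) (A - 1 - i%:R)^-1 - 1 <= (3 * K) ^+ q / A.
Proof.
move=> K1 A0; elim: q => [|q IH] h.
  by rewrite !expr0 big_ord0 mulr1 subrr lexx /= divr_ge0 // ltW.
have /andP[] := IH (fun i iq => h i (ltnW iq)).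
rewrite big_ord_recr /=; have [q0 qK] := h q (ltnSn q).
set P := \prod_(i < q) _; set B := A - 1 - q%:R in q0 qK *.
set D := A ^+ q * P - 1 => D0 D1.
(* The deviation [D] becomes D A/B + (q+1)/B, where A/B <= K and 1/B <= K/A; since q + 1 <= 2
   (3K)^q, the bound grows by at most the factor 3K. *)
have -> : A ^+ q.+1 * (P * B^-1) - 1 = D * (A / B) + (q%:R + 1) / B.
  have B0 : B != 0 by rewrite gt_eqF.
  have qE : q%:R = A - 1 - B by rewrite /B; ring.
  by rewrite /D qE exprS; clearbody B P; field.
have AB0 : 0 <= A / B by rewrite divr_ge0 // ltW.
have ABK : A / B <= K by rewrite ler_pdivrMr.
have q10 : 0 <= q%:R + 1 :> R by rewrite addr_ge0.
have B1 : B^-1 <= K / A.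
  by rewrite ler_pdivlMr // mulrC ler_pdivrMr.
apply/andP; split.
  by apply: addr_ge0; [exact: mulr_ge0 | rewrite divr_ge0 // ltW].
have K0 : 0 <= K by apply: le_trans K1.
apply: (@le_trans _ _ ((3 * K) ^+ q / A * K + (q%:R + 1) * (K / A))).
  by apply: lerD; [apply: ler_pM | apply: ler_wpM2l].
have qle : q%:R + 1 <= 2 * (3 * K) ^+ q.
  apply: (@le_trans _ _ (2 ^+ q)).
    by rewrite natr1 -natrX ler_nat ltn_expl.
  apply: (@le_trans _ _ ((3 * K) ^+ q)); last first.
    by rewrite ler_peMl ?exprn_ge0 ?mulr_ge0 // ler1n.
  by rewrite lerXn2r ?nnegrE ?mulr_ge0 //; lra.
have KA : 0 <= K / A by rewrite divr_ge0 // ltW.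
have -> : (3 * K) ^+ q / A * K + (q%:R + 1) * (K / A) =
  ((3 * K) ^+ q + (q%:R + 1)) * (K / A) by ring.
have -> : (3 * K) ^+ q.+1 / A = ((3 * K) ^+ q + 2 * (3 * K) ^+ q) * (K / A).
  by rewrite exprS; ring.
by rewrite ler_wpM2r // lerD2l.
Qed.

(** For such x, 1/(1-x) <= 1 + 2x <= e^{2x}. *)
Lemma onem_ge_expR (R : realType) (x : R) : 0 <= x -> x <= 2^-1 -> expR (- (2 * x)) <= 1 - x.
Proof.
move=> x0 x1; have y0 : 0 < 1 - x by lra.
rewrite expRN -[X in _ <= X]invrK lef_pV2 ?posrE ?expR_gt0 ?invr_gt0 //.
apply: le_trans (expR_ge1Dx _); rewrite -[X in X <= _]mul1r ler_pdivrMr //.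
have h : 0 <= x * (1 - 2 * x) by apply: mulr_ge0 => //; lra.
by lra.
Qed.

(** Let A = N + g and w = z/A. As m <= A, the node polynomial at w has modulus at least e^{-2L},
    while it differs from Q(z) by at most e^{3KL}/A. A zero of Q in the closed disk would force A <=
    e^{3KL+2L}. All constants depend only on k, g and [lam]. *)
Lemma HPden_neq0 (R : realType) (k : nat) (g : R) (lam : 'I_k -> R) :
  (forall p : nat, g <> - p%:R) -> (forall j, lam j <> 0) ->
  exists n0 : nat, forall (n : nat) (m : 'I_k -> nat),
    (n0 <= n)%N -> (forall j, (m j <= n)%N) ->
    1 < n%:R + g /\ forall z : R[i], `|z| <= 1 -> (HPden g lam n m).[z] != 0.
Proof.
move=> hg hlam; pose L : R := \sum_j `|lam j|.
have hL j : `|lam j| <= L by rewrite /L (bigD1 j) //= lerDl sumr_ge0.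
have L0 : 0 <= L by rewrite sumr_ge0.
(* [K] bounds A/(A-1-i) for i < m: the denominator is at least n/2, and A <= kn + 2n because m <=
   kn. *)
pose K : R := 2 * (k%:R + 2).
have K1 : 1 <= K by have : 0 <= k%:R :> R by []; rewrite /K; lra.
(* Once n > 2T, A exceeds [T]; this gives L/A <= 1/2 and contradicts the bound that a zero would
   impose on A. *)
pose T : R := `|g| + 1 + 2 * L + expR (3 * K * L + 2 * L).
have T1 : 1 < T.
  have := expR_gt0 (3 * K * L + 2 * L); have := normr_ge0 g; rewrite /T; lra.
exists (Num.bound (2 * T)) => n m n0 mn.
have nT : 2 * T < n%:R.
  apply: lt_le_trans (archi_boundP _) _; first by lra.
  by rewrite ler_nat.
have gT : `|g| <= T by have := expR_gt0 (3 * K * L + 2 * L); rewrite /T; lra.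
have ng : n%:R / 2 <= n%:R + g.
  have : - g <= `|g| by rewrite ler_normr lexx orbT.
  by lra.
split; first by lra.
move=> z z1; set M := mtotal m; set N := (n + M)%N; pose A := N%:R + g.
have M0 : 0 <= M%:R :> R by [].
have AE : A = n%:R + M%:R + g by rewrite /A /N natrD.
have AT : T < A by rewrite AE; lra.
have A0 : 0 < A by lra.
have MA : M%:R <= A by rewrite AE; lra.
have Mk : M%:R <= k%:R * n%:R :> R.
  rewrite -natrM ler_nat /M /mtotal; apply: (leq_trans (n := (\sum_(j < k) n)%N)).
    by apply: leq_sum => j _; exact: mn.
  by rewrite sum_nat_const card_ord.
have AK i : (i < M)%N -> 0 < A - 1 - i%:R /\ A <= K * (A - 1 - i%:R).
  move=> iM; have : i%:R + 1 <= M%:R :> R by rewrite natr1 ler_nat.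
  have gn : g <= n%:R / 2 by have := ler_norm g; lra.
  move=> iM1; have h : n%:R / 2 <= A - 1 - i%:R by rewrite AE; lra.
  split; first by lra.
  apply: (@le_trans _ _ (K * (n%:R / 2))); last by rewrite ler_wpM2l //; lra.
  have -> : K * (n%:R / 2) = k%:R * n%:R + 2 * n%:R by rewrite /K; field.
  by rewrite AE; lra.
pose u q : R := pochhammer g (N - q) / pochhammer g N.
have uE q : (q <= M)%N -> u q = \prod_(i < q) (A - 1 - i%:R)^-1.
  move=> qM; have qN : (q <= N)%N by rewrite (leq_trans qM) // leq_addl.
  have pq := pochhammer_neq0 (N - q) hg; have pN := pochhammer_neq0 N hg.
  move: pN; rewrite /u -{1 3}(subnK qN) pochhammer_falling subnK //.
  rewrite prodfV mulf_eq0 negb_or => /andP[_ p2].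
  have -> : \prod_(i < q) (A - 1 - i%:R) = \prod_(t < q) (g + N%:R - 1 - t%:R).
    by apply: eq_bigr => i _; rewrite /A; ring.
  by field; rewrite pq p2.
have uB q : (q <= M)%N -> `|u q - A^-1 ^+ q| <= (3 * K / A) ^+ q / A.
  move=> qM; rewrite uE //.
  have /andP[h1 h2] := prod_shift_bound K1 A0 (fun i iq => AK i (leq_trans iq qM)).
  have Aq0 : A ^+ q != 0 by rewrite expf_neq0 // gt_eqF.
  have -> : \prod_(i < q) (A - 1 - i%:R)^-1 - A^-1 ^+ q =
     A^-1 ^+ q * (A ^+ q * \prod_(i < q) (A - 1 - i%:R)^-1 - 1).
    by rewrite exprVn mulrBr mulrA mulVf // mul1r mulr1.
  have Ai : 0 <= A^-1 ^+ q by rewrite exprn_ge0 // invr_ge0 ltW.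
  rewrite normrM !ger0_norm // exprMn -[X in _ <= X]mulrA mulrCA.
  by rewrite ler_wpM2l // mulrC.
set c := fun q => (node_poly lam m)`_q.
set w := (A^-1)%:C * z.
have hC : (node_poly (fun j => (lam j)%:C : R[i]) m).[w] = \sum_(q < M.+1) (c q)%:C * w ^+ q.
  have hlC j : (lam j)%:C <> 0 :> R[i] by move=> /complexI /hlam.
  rewrite (@horner_coef_wide _ M.+1) ?size_node_poly //.
  by apply: eq_bigr => q _; rewrite map_node_poly.
have low : (expR (- (2 * L)))%:C <= `|(node_poly (fun j => (lam j)%:C : R[i]) m).[w]|.
  rewrite horner_node_poly normr_prod.
  apply: (@le_trans _ _ (\prod_(j < k) (expR (- (2 * (L / A))) ^+ m j)%:C)).
    rewrite -rmorph_prod lecR prodrXr -expRM_natl ler_expR -/(mtotal m) -/M.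
    have -> : M%:R * - (2 * (L / A)) = - (2 * (L * (M%:R / A))) by ring.
    rewrite lerN2 ler_wpM2l // -[X in _ <= X]mulr1 ler_wpM2l //.
    by rewrite ler_pdivrMr // mul1r.
  apply: ler_prod => j _; rewrite ler0c exprn_ge0 ?expR_ge0 //= normrX rmorphXn.
  apply: lerXn2r; [by rewrite nnegrE ler0c expR_ge0 | by rewrite nnegrE normr_ge0 |].
  have LA : L / A <= 2^-1.
    by rewrite ler_pdivrMr // ; have := expR_gt0 (3 * K * L + 2 * L);
       have := normr_ge0 g; move: AT; rewrite /T; lra.
  have LA0 : 0 <= L / A by rewrite divr_ge0 // ltW.
  apply: (@le_trans _ _ ((1 - L / A)%:C)); first by rewrite lecR onem_ge_expR.
  apply: le_trans (lerB_dist _ _); rewrite normr1 rmorphB rmorph1 lerB //.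
  have Ai0 : 0 <= A^-1 by rewrite invr_ge0 ltW.
  have -> : (lam j)%:C * w = (lam j * A^-1)%:C * z by rewrite rmorphM /w mulrA.
  rewrite normrM norm_real_complex -[X in _ <= X]mulr1; apply: ler_pM => //.
    by rewrite ler0c normr_ge0.
  by rewrite lecR normrM (ger0_norm Ai0) ler_wpM2r.
apply/eqP => Qz.
have dQ : (node_poly (fun j => (lam j)%:C : R[i]) m).[w] =
    \sum_(q < M.+1) (c q * (A^-1 ^+ q - u q))%:C * z ^+ q.
  transitivity (\sum_(q < M.+1) (c q)%:C * w ^+ q - (HPden g lam n m).[z]).
    by rewrite Qz subr0 hC.
  rewrite horner_poly -sumrB; apply: eq_bigr => q _.
  by rewrite /w exprMn -/(c q) -/(u q) -rmorphXn mulrA -rmorphM -mulrBl -rmorphB -mulrBr.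
have up : `|(node_poly (fun j => (lam j)%:C : R[i]) m).[w]| <= (expR (3 * K * L) / A)%:C.
  rewrite dQ; apply: le_trans (ler_norm_sum _ _ _) _.
  apply: (@le_trans _ _ (\sum_(q < M.+1) (`|c q| * (3 * K / A) ^+ q / A)%:C)).
    apply: ler_sum => q _; rewrite normrM norm_real_complex normrX normrM.
    rewrite -[X in _ <= X]mulr1; apply: ler_pM; rewrite ?ler0c ?mulr_ge0 ?exprn_ge0 //.
      by rewrite lecR -mulrA ler_wpM2l // distrC uB // -ltnS.
    by rewrite exprn_ile1.
  rewrite -rmorph_sum lecR -mulr_suml ler_wpM2r ?invr_ge0 ?(ltW A0) //.
  have x0 : 0 <= 3 * K / A by rewrite divr_ge0 ?(ltW A0) //; lra.
  apply: le_trans (norm_node_poly_le hL hlam x0 (erefl M)) _.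
  rewrite ler_expR; have -> : L * (3 * K / A) * M%:R = 3 * K * L * (M%:R / A) by ring.
  have KL : 0 <= 3 * K * L.
    by apply: mulr_ge0 => //; apply: mulr_ge0 => //; apply: le_trans K1.
  rewrite -[X in _ <= X]mulr1 ler_wpM2l //.
  by rewrite ler_pdivrMr // mul1r.
have := le_trans low up; rewrite lecR ler_pdivlMr // => h.
have : A <= expR (3 * K * L + 2 * L).
  by rewrite expRD -ler_pdivrMr ?expR_gt0 // -expRN mulrC.
by have := normr_ge0 g; move: AT; rewrite /T; lra.
Qed.

(** * Quotients of polynomials as trigonometric series *)

Lemma gt0_complexP (R : realType) (z : R[i]) : 0 < z -> exists2 e : R, 0 < e & z = e%:C.
Proof.
case: z => a b; rewrite ltcE /= => /andP[/eqP -> a0].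
by exists a.
Qed.

Lemma cvg_geometric_bound (R : realType) (u : nat -> R[i]) (C r : R) :
  0 <= r < 1 -> (forall n, `|u n| <= (C * r ^+ n)%:C) ->
  ((u : nat -> R[i]^o) @ \oo --> (0 : R[i]^o)).
Proof.
move=> /andP[r0 r1] h; apply/cvgrPdist_lt => eps /gt0_complexP[e e0 ->].
have : (fun n => C * r ^+ n) @ \oo --> (0 : R).
  rewrite -[X in _ --> X](mulr0 C); apply: cvgMl_tmp; apply: cvg_expr.
  by rewrite ger0_norm.
move/cvgrPdist_lt => /(_ e e0); apply: filterS => n; rewrite !sub0r !normrN => hn.
by apply: le_lt_trans (h n) _; rewrite ltcR (le_lt_trans (ler_norm _)).
Qed.

(** The coefficients of W(z) / (1 - a z), where W is the power series with coefficients [w]. *)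
Fixpoint geometric_conv (R : pzRingType) (a : R) (w : nat -> R) (l : nat) : R :=
  if l is l'.+1 then a * geometric_conv a w l' + w l else w 0%N.

(** The constant K = C r / (r - A) solves A K + C r = K r, so the bound reproduces itself along the
    recursion. *)
Lemma norm_geometric_conv (R : realType) (a : R[i]) (w : nat -> R[i]) (A C r : R) :
  `|a| <= A%:C -> 0 <= A < r -> (forall l, `|w l| <= (C * r ^+ l)%:C) ->
  forall l, `|geometric_conv a w l| <= (C * r / (r - A) * r ^+ l)%:C.
Proof.
move=> aA /andP[A0 Ar] hw.
have C0 : 0 <= C.
  by rewrite -ler0c; apply: le_trans (normr_ge0 _) (le_trans (hw 0%N) _); rewrite expr0 mulr1.
have rA : 0 < r - A by rewrite subr_gt0.
elim=> [|l IH] /=.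
  apply: le_trans (hw 0%N) _; rewrite lecR !expr0 !mulr1 ler_pdivlMr //.
  by rewrite ler_wpM2l // gerBl.
apply: le_trans (ler_normD _ _) _; rewrite normrM.
apply: (@le_trans _ _ (A%:C * (C * r / (r - A) * r ^+ l)%:C + (C * r ^+ l.+1)%:C)).
  by apply: lerD => //; apply: ler_pM.
rewrite -rmorphM -rmorphD lecR exprS.
by rewrite le_eqVlt; apply/orP; left; apply/eqP; field; rewrite gt_eqF.
Qed.

Lemma geometric_conv_mul (R : comNzRingType) (a : R) (w : nat -> R) (T : {poly R}) (l : nat) :
  \sum_(q < l.+1) ((1 - a%:P * 'X) * T)`_q * geometric_conv a w (l - q) =
  \sum_(q < l.+1) T`_q * w (l - q)%N.
Proof.
set v := geometric_conv a w.
have cE q : ((1 - a%:P * 'X) * T)`_q = T`_q - (if q is q'.+1 then a * T`_q' else 0).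
  rewrite mulrBl mul1r coefB -mulrA coefCM coefXM.
  by case: q => //=; rewrite mulr0.
under eq_bigr do rewrite cE mulrBl.
rewrite sumrB [X in _ - X]big_ord_recl /= mul0r add0r.
rewrite [X in X - _]big_ord_recr [RHS]big_ord_recr /= subnn /= addrAC -sumrB.
congr (_ + _); apply: eq_bigr => q _.
rewrite /bump /= add1n; have -> : (l - q = (l - q.+1).+1)%N by rewrite subnSK.
by rewrite /v /=; ring.
Qed.

Lemma geometric_conv_partial (R : comNzRingType) (a z : R) (w : nat -> R) (N : nat) :
  (1 - a * z) * (\sum_(q < N.+1) geometric_conv a w q * z ^+ q) =
  \sum_(q < N.+1) w q * z ^+ q - a * z * (geometric_conv a w N * z ^+ N).
Proof.
elim: N => [|N IH]; first by rewrite !big_ord1 /=; ring.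
by rewrite big_ord_recr [in RHS]big_ord_recr mulrDr IH /= exprS; ring.
Qed.

(** Divide by one factor 1 - a z at a time. Geometric decay of the coefficients is carried through
    the induction because it makes the last term of [geometric_conv_partial] tend to 0 on the unit
    circle. *)
Lemma power_series_prod (R : realType) (P : {poly R[i]}) (s : seq R[i]) :
  (forall a, a \in s -> `|a| < 1) ->
  exists w : nat -> R[i],
    [/\ forall l, \sum_(q < l.+1) (\prod_(a <- s) (1 - a%:P * 'X))`_q * w (l - q)%N = P`_l,
        exists C r : R, 0 < r < 1 /\ forall l, `|w l| <= (C * r ^+ l)%:C &
        forall z : R[i], `|z| = 1 ->
          ((fun N => \sum_(q < N.+1) w q * z ^+ q : R[i]^o) @ \oo -->
           (P.[z] / (\prod_(a <- s) (1 - a%:P * 'X)).[z] : R[i]^o))].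
Proof.
elim: s => [|a s IH] hs.
  exists (fun l => P`_l); split.
  - move=> l; rewrite big_nil big_ord_recl big1 ?coef1 /= ?mul1r ?subn0 ?addr0 //.
    by move=> q _; rewrite coef1 mul0r.
  - pose B : R := \sum_(q < size P) complex.Re `|P`_q|.
    have RE (u : R[i]) : `|u| = (complex.Re `|u|)%:C by rewrite normc_def.
    have Re0 (u : R[i]) : 0 <= complex.Re `|u| by rewrite -ler0c -RE.
    (* The factor 2^(size P) compensates the rate 1/2 for the finitely many nonzero coefficients. *)
    exists (B * 2 ^+ size P), 2^-1; split; first by apply/andP; split; lra.
    move=> l; case: (ltnP l (size P)) => lP; last first.
      rewrite nth_default // normr0 ler0c mulr_ge0 // ?exprn_ge0 ?invr_ge0 //.
      by apply: mulr_ge0; [apply: sumr_ge0 => ? _; exact: Re0 | exact: exprn_ge0].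
    rewrite RE lecR; apply: (@le_trans _ _ B).
      by rewrite /B (bigD1 (Ordinal lP)) // lerDl; apply: sumr_ge0 => ? _; exact: Re0.
    have B0 : 0 <= B by apply: sumr_ge0 => ? _; exact: Re0.
    rewrite -mulrA ler_peMr // exprVn -[size P](subnK (ltnW lP)) exprD.
    by rewrite mulfK ?expf_neq0 // ?pnatr_eq0 // exprn_ege1 // ler1n.
  - move=> z _; rewrite big_nil hornerC divr1.
    apply/cvgrPdist_lt => eps eps0; near=> N.
    rewrite (@horner_coef_wide _ N.+1) ?subrr ?normr0 //.
    by rewrite leqW //; near: N; exact: nbhs_infty_ge.
have hs' b : b \in s -> `|b| < 1 by move=> bs; apply: hs; rewrite in_cons bs orbT.
have [w [hw [C [r [r01 hC]]] hl]] := IH hs'.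
have a1 := hs a (mem_head _ _).
have [A AE] : exists A : R, `|a| = A%:C by rewrite normc_def; eexists.
have A0 : 0 <= A by rewrite -ler0c -AE.
have A1 : A < 1 by move: a1; rewrite AE -[1]/(1%:C) ltcR.
move: r01 => /andP[r0 r1].
(* A rate at least r, below 1, and strictly above A as the recursion requires. *)
pose r' := Num.max r ((1 + A) / 2).
have r'r : r <= r' by rewrite le_max lexx.
have r'A : A < r' by rewrite lt_max; apply/orP; right; lra.
have r'1 : r' < 1 by rewrite gt_max r1 /=; lra.
have r'0 : 0 < r' by lra.
have C0 : 0 <= C.
  by rewrite -ler0c; apply: le_trans (normr_ge0 _) (le_trans (hC 0%N) _); rewrite expr0 mulr1.
have hC' l : `|w l| <= (C * r' ^+ l)%:C.
  apply: le_trans (hC l) _; rewrite lecR ler_wpM2l // lerXn2r ?nnegrE //; exact: ltW.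
have Ar' : 0 <= A < r' by rewrite A0.
have aA : `|a| <= A%:C by rewrite AE.
have hv := norm_geometric_conv aA Ar' hC'.
exists (geometric_conv a w); split.
- by move=> l; rewrite big_cons geometric_conv_mul hw.
- by exists (C * r' / (r' - A)), r'; rewrite r'0 r'1.
move=> z z1; rewrite big_cons hornerM hornerD hornerN hornerM !hornerC hornerX.
have az0 : 1 - a * z != 0.
  rewrite subr_eq0; apply/eqP => e.
  have : `|a * z| < 1 by rewrite normrM z1 mulr1.
  by rewrite -e normr1 ltxx.
have -> : (fun N => \sum_(q < N.+1) geometric_conv a w q * z ^+ q : R[i]^o) =
   (fun N => (1 - a * z)^-1 * (\sum_(q < N.+1) w q * z ^+ q
      - a * z * (geometric_conv a w N * z ^+ N))).
  by apply/funext => N; rewrite -geometric_conv_partial mulrA mulVf // mul1r.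
rewrite [X in _ --> X](_ : _ = (1 - a * z)^-1 *
  (P.[z] / (\prod_(b <- s) (1 - b%:P * 'X)).[z] - a * z * 0)); last first.
  by rewrite mulr0 subr0 invfM mulrCA.
apply: (@cvgMl_tmp _ _ _ _ _ _); apply: cvgB; first exact: hl.
apply: (@cvgMl_tmp _ _ _ _ _ _).
apply: (@cvg_geometric_bound _ _ (C * r' / (r' - A)) r'); first by rewrite r'1 ltW.
by move=> N; rewrite normrM normrX z1 expr1n mulr1.
Unshelve. all: end_near. Qed.

(** Since the constant term is 1 and every root lies outside the closed unit disk, Q is the product
    of the 1 - z/s over its roots s, with |1/s| < 1. *)
Lemma power_series_quotient (R : realType) (P Q : {poly R[i]}) :
  Q`_0 = 1 -> (forall z : R[i], `|z| <= 1 -> Q.[z] != 0) ->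
  exists w : nat -> R[i],
    (forall l, \sum_(q < l.+1) Q`_q * w (l - q)%N = P`_l) /\
    forall z : R[i], `|z| = 1 ->
      ((fun N => \sum_(q < N.+1) w q * z ^+ q : R[i]^o) @ \oo --> (P.[z] / Q.[z] : R[i]^o)).
Proof.
move=> Q0 hQ; have [s sE] := closed_field_poly_normal Q.
have Qn0 : Q != 0 by apply/eqP => e; move: Q0; rewrite e coef0 => /eqP; rewrite eq_sym oner_eq0.
have rs z : z \in s -> 1 < `|z|.
  move=> zs; rewrite real_ltNge ?normr_real ?real1 //; apply/negP => /hQ.
  by rewrite -/(root Q z) sE rootZ ?lead_coef_eq0 // root_prod_XsubC zs.
have s0 z : z \in s -> z != 0 by move=> /rs h; rewrite -normr_gt0 (lt_trans _ h).
have QE : Q = \prod_(a <- [seq z^-1 | z <- s]) (1 - a%:P * 'X).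
  have pE (t : seq R[i]) : {subset t <= s} -> \prod_(z <- t) ('X - z%:P) =
      (\prod_(z <- t) - z) *: \prod_(a <- [seq z^-1 | z <- t]) (1 - a%:P * 'X).
    elim: t => [|z t IH] ht; first by rewrite !big_nil scale1r.
    rewrite /= !big_cons IH; last by move=> y yt; apply: ht; rewrite in_cons yt orbT.
    have z0 := s0 z (ht z (mem_head _ _)).
    have -> : 'X - z%:P = (- z) *: (1 - (z^-1)%:P * 'X).
      rewrite scalerBr mul_polyC scalerA mulNr divff // scaleN1r opprK addrC.
      by rewrite alg_polyC polyCN.
    by rewrite -scalerAl -scalerAr scalerA.
  have e : lead_coef Q * (\prod_(z <- s) - z) = 1.
    have h0 : (\prod_(a <- [seq z^-1 | z <- s]) (1 - a%:P * 'X)).[0] = 1.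
      rewrite horner_prod big_map big1 // => z _.
      by rewrite hornerD hornerN hornerM !hornerC hornerX mulr0 subr0.
    by move: Q0; rewrite -horner_coef0 {1}sE pE // scalerA hornerZ h0 mulr1.
  by rewrite {1}sE pE // scalerA e scale1r.
have [|w [h1 _ h3]] := @power_series_prod R P [seq z^-1 | z <- s].
  by move=> a /mapP[z /rs z1 ->]; rewrite normfV invf_lt1 // (lt_trans ltr01).
by exists w; rewrite QE.
Qed.

Lemma conv_inj (R : comNzRingType) (Q : {poly R}) (a b : nat -> R) (N : nat) :
  Q`_0 = 1 ->
  (forall l, (l <= N)%N -> \sum_(q < l.+1) Q`_q * a (l - q)%N = \sum_(q < l.+1) Q`_q * b (l - q)%N) ->
  forall l, (l <= N)%N -> a l = b l.
Proof.
move=> Q0 h l; have [k] := ubnP l; elim: k l => // k IH l lk lN.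
have := h l lN; rewrite !big_ord_recl /= Q0 !mul1r subn0.
rewrite (eq_bigr (fun q : 'I_l => Q`_(bump 0 q) * b (l - bump 0 q)%N)); first by move/addIr.
move=> q _; rewrite IH // /bump /= add1n ?(leq_trans (leq_subr _ _)) //.
by have := ltn_ord q; lia.
Qed.

(** * Trigonometric polynomials as algebraic polynomials on the unit circle *)

Lemma cis_int (R : realType) (i N : nat) (x : R) :
  cis ((i%:Z - N%:Z)%:~R * x) = cis x ^+ i * (cis x)^-1 ^+ N.
Proof. by rewrite -cisN -!cis_nat -cisD rmorphB /= -!pmulrn; congr cis; ring. Qed.

Lemma cis_neq0 (R : realType) (x : R) : cis x != 0.
Proof. by rewrite -normr_eq0 norm_cis oner_eq0. Qed.

Lemma tevalE (R : realType) (N : nat) (c : int -> R[i]) (x : R) :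
  teval N c x * cis x ^+ N = (\poly_(i < N.*2.+1) c (i%:Z - N%:Z)).[cis x].
Proof.
rewrite horner_poly /teval /zsum mulr_suml; apply: eq_bigr => i _.
by rewrite cis_int mulrA exprVn divfK // expf_neq0 // cis_neq0.
Qed.

(** The coefficients of e^{-iNx} W(e^{ix}), for W of degree at most 2N. *)
Definition tcoef (R : realType) (N : nat) (W : {poly R[i]}) (p : int) : R[i] :=
  if (`|p| <= N)%N then W`_`|p + N%:Z| else 0.

Lemma tpoly_tcoef (R : realType) (N : nat) (W : {poly R[i]}) : tpoly N (tcoef N W).
Proof. by move=> p pN; rewrite /tcoef leqNgt pN. Qed.

Lemma teval_tcoef (R : realType) (N : nat) (W : {poly R[i]}) (x : R) :
  (size W <= N.*2.+1)%N -> teval N (tcoef N W) x = W.[cis x] / cis x ^+ N.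
Proof.
move=> sW; have z0 : cis x ^+ N != 0 by rewrite expf_neq0 // cis_neq0.
apply: (mulIf z0); rewrite tevalE divfK //.
rewrite (horner_coef_wide _ sW) horner_poly; apply: eq_bigr => i _.
rewrite /tcoef subrK ifT //; have := ltn_ord i; lia.
Qed.

(** This is z^N p(1/z); it keeps expressions in e^{-ix} polynomial in e^{ix}. *)
Definition rev_poly (R : nzRingType) (N : nat) (p : {poly R}) : {poly R} :=
  \poly_(i < N.+1) p`_(N - i).

Lemma horner_rev_poly (R : fieldType) (N : nat) (p : {poly R}) (z : R) :
  (size p <= N.+1)%N -> z != 0 -> (rev_poly N p).[z] = z ^+ N * p.[z^-1].
Proof.
move=> sp z0; rewrite horner_poly (horner_coef_wide _ sp) mulr_sumr.
rewrite (reindex_inj rev_ord_inj) /=; apply: eq_bigr => i _.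
have iN : (i <= N)%N by rewrite -ltnS.
rewrite subSS subKn // mulrCA; congr (_ * _).
have -> : z ^+ N = z ^+ (N - i) * z ^+ i by rewrite -exprD subnK.
by rewrite exprVn mulfK // expf_neq0.
Qed.

Lemma zsumS (R : realType) (N : nat) (F : int -> R[i]) :
  zsum N.+1 F = F (- N.+1%:Z) + zsum N F + F N.+1%:Z.
Proof.
rewrite /zsum doubleS big_ord_recl big_ord_recr /= addrA.
congr (F _ + _ + F _); [lia | | rewrite /bump /=; lia].
by apply: eq_bigr => i _; congr F; rewrite /bump /=; lia.
Qed.

Lemma teval_cos_series (R : realType) (w : nat -> R[i]) (N : nat) (x : R) :
  teval N (cos_series w) x =
  (\sum_(q < N.+1) w q * cis x ^+ q + \sum_(q < N.+1) w q * (cis x)^-1 ^+ q) / 2.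
Proof.
elim: N => [|N IH].
  rewrite /teval /zsum !big_ord1 /cos_series subrr eqxx mul0r cis0 !expr0.
  by field.
rewrite /teval zsumS -[zsum N _]/(teval N (cos_series w) x) IH.
have -> : cos_series w (- N.+1%:Z) = w N.+1 / 2 by [].
have -> : cos_series w N.+1%:Z = w N.+1 / 2 by [].
have -> : cis ((- N.+1%:Z)%:~R * x) = (cis x)^-1 ^+ N.+1.
  by rewrite -[- _]sub0r -[0]/(0%N%:Z) cis_int expr0 mul1r.
have -> : cis ((N.+1%:Z)%:~R * x) = cis x ^+ N.+1.
  by rewrite -[N.+1%:Z]subr0 -[0]/(0%N%:Z) cis_int expr0 mulr1.
have recr (u : R[i]) :
    \sum_(q < N.+2) w q * u ^+ q = \sum_(q < N.+1) w q * u ^+ q + w N.+1 * u ^+ N.+1.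
  by rewrite big_ord_recr.
rewrite !recr; move: (cis x ^+ N.+1) ((cis x)^-1 ^+ N.+1) => a b.
by field.
Qed.

(** This encodes Q(e^{ix}) Q(e^{-ix}), the squared modulus of Q(e^{ix}) when Q has real
    coefficients. *)
Definition Qhat (R : realType) (M : nat) (Q : {poly R[i]}) : int -> R[i] :=
  tcoef M (Q * rev_poly M Q).

(** Divided by [Qhat], this is half the sum of P/Q at e^{ix} and at e^{-ix}; the power X^(D-M)
    centres both products at the exponent D. *)
Definition Phat (R : realType) (M D : nat) (Q P : {poly R[i]}) : int -> R[i] :=
  tcoef D (2^-1 *: (P * 'X^(D - M) * rev_poly M Q + rev_poly D P * Q)).

Lemma teval_Qhat (R : realType) (M : nat) (Q : {poly R[i]}) (x : R) :
  (size Q <= M.+1)%N -> teval M (Qhat M Q) x = Q.[cis x] * Q.[(cis x)^-1].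
Proof.
move=> sQ; rewrite teval_tcoef; last first.
  apply: leq_trans (size_polyMleq _ _) _.
  by have := size_poly M.+1 (fun i => Q`_(M - i)); rewrite -/(rev_poly M Q); lia.
rewrite hornerM horner_rev_poly ?cis_neq0 // -mulrA [_ * _ / _]mulrAC divff ?mul1r //.
by rewrite expf_neq0 // cis_neq0.
Qed.

Lemma teval_Phat (R : realType) (M D : nat) (Q P : {poly R[i]}) (x : R) :
  (size Q <= M.+1)%N -> (size P <= D.+1)%N -> (M <= D)%N ->
  teval D (Phat M D Q P) x =
  (P.[cis x] * Q.[(cis x)^-1] + P.[(cis x)^-1] * Q.[cis x]) / 2.
Proof.
move=> sQ sP MD; rewrite teval_tcoef; last first.
  apply: leq_trans (size_scale_leq _ _) _; apply: leq_trans (size_polyD _ _) _.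
  have s1 := size_poly M.+1 (fun i => Q`_(M - i)).
  have s2 := size_poly D.+1 (fun i => P`_(D - i)).
  have s3 := size_polyMleq (P * 'X^(D - M)) (rev_poly M Q).
  have s4 := size_polyMleq P 'X^(D - M); rewrite size_polyXn in s4.
  have s5 := size_polyMleq (rev_poly D P) Q.
  rewrite -/(rev_poly M Q) in s1; rewrite -/(rev_poly D P) in s2.
  rewrite geq_max; apply/andP; split; first by lia.
  apply: leq_trans s5 _; have := leq_add s2 sQ.
  by set e := (_ + _)%N; clearbody e; lia.
have z0 := cis_neq0 x.
rewrite hornerZ hornerD !hornerM hornerXn !horner_rev_poly //.
have zE : cis x ^+ D = cis x ^+ (D - M) * cis x ^+ M by rewrite -exprD subnK.
have a0 : cis x ^+ (D - M) != 0 by rewrite expf_neq0.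
have b0 : cis x ^+ M != 0 by rewrite expf_neq0.
rewrite zE; move: a0 b0; move: (cis x ^+ (D - M)) (cis x ^+ M) => a b a0 b0.
by field; rewrite a0 b0.
Qed.

(** * Hermite--Jacobi approximations *)

(* Up to a nonzero factor the sum is [\int_0^(lam j) Ugamma t dt], written
   without integral as the value at [lam j] of a primitive vanishing at [0]. *)
Lemma HPden_remainder_neq0 (R : realType) (k : nat) (g : R) (lam : 'I_k -> R) (n : nat)
    (m : 'I_k -> nat) (j : 'I_k) :
  (forall p : nat, g <> - p%:R) -> (forall i, lam i <> 0) -> 1 < n%:R + g ->
  0 < lam j -> (forall i, m i <> 0%N -> lam j <= lam i) ->
  \sum_(q < (n + mtotal m).+2)
    (HPden g lam n m)`_q * Ecoef g (lam j) ((n + mtotal m).+1 - q)%N <> 0.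
Proof.
move=> hg hlam n1 lj0 hj; set M := mtotal m; set N := (n + M)%N; set l := lam j in lj0 hj *.
have pN := pochhammer_neq0 N hg.
pose c q := (node_poly lam m)`_q.
pose S : {poly R} := \sum_(q < M.+1) (c q / ((N - q)%:R + g)) *: 'X^(M - q).
have qM (q : 'I_M.+1) : (q <= M)%N by rewrite -ltnS.
have d0 (q : 'I_M.+1) : (N - q)%:R + g != 0.
  apply: lt0r_neq0; have : n%:R <= (N - q)%:R :> R.
    by rewrite ler_nat /N -addnBA ?leq_addr.
  by lra.
have -> : \sum_(q < N.+2) (HPden g lam n m)`_q * Ecoef g l (N.+1 - q)%N =
    ((pochhammer g N)^-1 * l ^+ n.+1 * S.[l])%:C.
  rewrite (sum_coef_widen (fun q => Ecoef g l (N.+1 - q)%N) (size_poly _ _)); last first.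
    by rewrite ltnW // ltnS leq_addl.
  rewrite /S horner_sum mulr_sumr rmorph_sum; apply: eq_bigr => q _.
  rewrite coef_poly ltn_ord /Ecoef -rmorphM hornerZ hornerXn; congr (_%:C).
  have e : (N.+1 - q = (N - q).+1)%N.
    by rewrite subSn // (leq_trans (qM q)) // leq_addl.
  have -> : l ^+ (N.+1 - q) = l ^+ n.+1 * l ^+ (M - q).
    by rewrite -exprD; congr (_ ^+ _); rewrite e addSn /N addnBA.
  have pS : pochhammer g (N - q).+1 = pochhammer g (N - q) * (g + (N - q)%:R).
    by rewrite /pochhammer big_ord_recr.
  rewrite e pS -/M -/N -/(c q).
  have p1 := pochhammer_neq0 (N - q) hg; have p2 := d0 q.
  have p3 : g + (N - q)%:R != 0 by rewrite addrC.
  by field; rewrite ?p1 ?p2 ?p3 ?pN.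
rewrite -[0]/(0%:C) => /complexI /eqP.
rewrite mulf_eq0 mulf_eq0 invr_eq0 (negPf pN) expf_eq0 (gt_eqF lj0) andbF /= => /eqP Sl.
pose f (t : R) := t `^ (n%:R + g) * S.[t].
have ng0 : 0 < n%:R + g by lra.
have df (t : R) : 0 < t -> is_derive t 1 f (Ugamma g lam n m t).
  move=> t0; have ? := is_derive1_powR (n%:R + g) t0.
  apply: is_derive_eq; rewrite /GRing.scale /=.
  have tn0 : t != 0 by rewrite gt_eqF.
  have -> : t `^ (n%:R + g) = t `^ (n%:R + g - 1) * t.
    by rewrite mulrC mulr_powRB1 // ltW.
  rewrite /Ugamma.
  have -> : \prod_(p < k) (t - lam p) ^+ m p = t * S^`().[t] + (n%:R + g) * S.[t].
    transitivity (t ^+ M * (node_poly lam m).[t^-1]).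
      rewrite horner_node_poly /M /mtotal -prodrXr -big_split /=.
      by apply: eq_bigr => i _; rewrite -exprMn mulrBr mulr1 mulrCA divff // mulr1.
    rewrite (@horner_coef_wide _ M.+1) ?size_node_poly //.
    have -> : S^`() = \sum_(q < M.+1) (c q / ((N - q)%:R + g)) *: ('X^(M - q))^`().
      by rewrite /S linear_sum; apply: eq_bigr => q _; exact: derivZ.
    rewrite /S !horner_sum !mulr_sumr -big_split /=; apply: eq_bigr => q _.
    rewrite derivXn !hornerZ hornerMn !hornerXn exprVn -/(c q).
    have -> : t ^+ M = t ^+ (M - q) * t ^+ q by rewrite -exprD subnK.
    have tt : t * (t ^+ (M - q).-1 *+ (M - q)) = (M - q)%:R * t ^+ (M - q).
      case: (M - q)%N => [|i]; first by rewrite mulr0n mulr0 mul0r.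
      by rewrite /= exprS -mulr_natl; ring.
    rewrite [X in _ = X + _]mulrCA tt.
    have NE : (N - q)%:R = n%:R + (M - q)%:R :> R by rewrite -natrD /N addnBA.
    have := d0 q; rewrite NE => d1.
    by field; rewrite d1 expf_neq0.
  by ring.
have cf : {within `[0, l], continuous f}.
  apply/continuous_within_itvP => //; split.
  - move=> t; rewrite in_itv/= => /andP[t0 _]; have ? := df t t0.
    by apply/differentiable_continuous/derivable1_diffP; apply: ex_derive.
  - rewrite /f powR0 ?gt_eqF // mul0r -[X in _ --> X](mul0r S.[0]).
    apply: cvgM; first exact: powR_cvg0.
    by apply: cvg_at_right_filter; exact: continuous_horner.
  - apply: cvg_at_left_filter; have ? := df l lj0.
    by apply/differentiable_continuous/derivable1_diffP; apply: ex_derive.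
have fe : f 0 = f l by rewrite /f Sl mulr0 powR0 ?mul0r // gt_eqF.
have df' (t : R) : t \in `]0, l[ -> derivable f t 1.
  by rewrite in_itv/= => /andP[t0 _]; have ? := df t t0; apply: ex_derive.
(* Were the sum zero, Rolle's theorem would give a zero of U in (0, lam_j); but the positive zeros
   of U are the lam_i with m_i > 0, none of which is below lam_j. *)
have [t tI dt] := Rolle lj0 df' cf fe.
move: tI; rewrite in_itv/= => /andP[t0 tl].
have [_ e1] := df t t0; have [_ e2] := dt; move: e1; rewrite e2 => /esym/eqP.
rewrite /Ugamma mulf_eq0 gt_eqF ?powR_gt0 //= => /prodf_eq0[i _].
rewrite expf_eq0 subr_eq0 => /andP[mi /eqP ti].
by have := hj i; rewrite -ti leNgt tl => /(_ ltac:(by move=> e; rewrite e in mi)).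
Qed.

Lemma horner_conj_real (R : realType) (Q : {poly R[i]}) (z : R[i]) :
  (forall q, (Q`_q)^* = Q`_q) -> (Q.[z])^* = Q.[z^*].
Proof.
move=> hQ; rewrite !horner_coef rmorph_sum; apply: eq_bigr => q _.
by rewrite rmorphM rmorphXn; congr (_ * _); exact: hQ.
Qed.

(** The expansion w of P_j/Q converges on the unit circle, so its cosine series converges to the
    quotient of [Phat] by [Qhat]. Up to the order n + m both w and the given coefficients have the
    same product with Q, hence coincide. *)
Lemma HJ_approx_hat (R : realType) (k : nat) (n : nat) (m : 'I_k -> nat)
    (a : 'I_k -> nat -> R[i]) (Q : {poly R[i]}) (P : 'I_k -> {poly R[i]}) :
  Q`_0 = 1 -> (size Q <= (mtotal m).+1)%N ->
  (forall z : R[i], `|z| <= 1 -> Q.[z] != 0) ->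
  (forall j, (m j <= n)%N) ->
  (forall j, (size (P j) <= (ndeg n m j).+1)%N /\
     forall l : nat, (l <= n + mtotal m)%N ->
       \sum_(q < l.+1) Q`_q * a j (l - q)%N = (P j)`_l) ->
  HJ_approx (fun j => cos_series (a j)) n m (Qhat (mtotal m) Q)
    (fun j => Phat (mtotal m) (ndeg n m j) Q (P j)).
Proof.
move=> Q0 sQ hQ mn hP.
have MD j : (mtotal m <= ndeg n m j)%N by have := mn j; rewrite /ndeg; lia.
have z1 (x : R) : `|(cis x)^-1| = 1 by rewrite normfV norm_cis invr1.
split.
- exact: tpoly_tcoef.
- by move=> j; exact: tpoly_tcoef.
- by move=> x; rewrite teval_Qhat // mulf_neq0 // hQ ?norm_cis ?z1.
move=> j; have [w [hw cw]] := power_series_quotient (P j) Q0 hQ.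
have [sP hPj] := hP j; exists (cos_series w); split.
  move=> x.
  have -> : (fun N => teval N (cos_series w) x : R[i]^o) = (fun N =>
     (\sum_(q < N.+1) w q * cis x ^+ q + \sum_(q < N.+1) w q * (cis x)^-1 ^+ q) * 2^-1).
    by apply/funext => N; rewrite teval_cos_series.
  rewrite teval_Qhat // teval_Phat //.
  have q1 : Q.[cis x] != 0 by rewrite hQ ?norm_cis.
  have q2 : Q.[(cis x)^-1] != 0 by rewrite hQ ?z1.
  rewrite [X in _ --> X](_ : _ =
    ((P j).[cis x] / Q.[cis x] + (P j).[(cis x)^-1] / Q.[(cis x)^-1]) * 2^-1); last first.
    by field; rewrite q1 q2.
  by apply: cvgMr_tmp; apply: cvgD; apply: cw; rewrite ?norm_cis ?z1.
move=> l lN; rewrite /cos_series.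
have h : a j `|l|%N = w `|l|%N.
  by apply: (conv_inj (N := (n + mtotal m)%N) Q0) => // i iN; rewrite hPj // hw.
case: eqP => [l0|_]; last by rewrite h subrr.
by move: h; rewrite l0 /= => ->; rewrite subrr.
Qed.

(** * Comparison with Hermite--Pade approximations *)

(** Cosine is injective on [0, pi], so equally spaced angles there give more distinct points of the
    circle than p - q could have roots. *)
Lemma circle_poly_eq (R : realType) (p q : {poly R[i]}) :
  (forall x : R, p.[cis x] = q.[cis x]) -> p = q.
Proof.
move=> h; apply/eqP; rewrite -subr_eq0; apply: contraT => pq0.
set n := size (p - q); have pi0 := pi_gt0 R.
pose t (i : nat) : R := pi * (i%:R / n.+1%:R).
have tI i : (i < n.+1)%N -> t i \in `[0, pi].
  move=> ni; rewrite in_itv /= /t; apply/andP; split.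
    by rewrite mulr_ge0 ?divr_ge0 // ltW.
  by rewrite ler_piMr ?(ltW pi0) // ler_pdivrMr // mul1r ler_nat ltnW.
have tinj i j : t i = t j -> i = j.
  move/(mulfI (lt0r_neq0 pi0))/(divIf (_ : n.+1%:R != 0)) => e.
  by apply/eqP; rewrite -(eqr_nat R) e // pnatr_eq0.
pose rs := [seq cis (t i) | i <- iota 0 n.+1].
have urs : uniq rs.
  rewrite map_inj_in_uniq ?iota_uniq // => i j; rewrite !mem_iota !add0n /= => iI jI.
  by case=> ec _; apply: tinj; apply: cos_inj ec; apply: tI.
have ars : all (root (p - q)) rs.
  by apply/allP => _ /mapP[i _ ->]; rewrite rootE hornerD hornerN h subrr.
by have := max_poly_roots pq0 ars urs; rewrite size_map size_iota -/n ltnNge leqnSn.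
Qed.

Lemma teval_opp (R : realType) (N : nat) (c : int -> R[i]) (x : R) :
  teval N (fun p => c (- p)) x = teval N c (- x).
Proof.
rewrite /teval /zsum (reindex_inj rev_ord_inj) /=; apply: eq_bigr => i _.
have -> : ((N.*2.+1 - i.+1)%N%:Z - N%:Z) = - (i%:Z - N%:Z) :> int.
  by have := ltn_ord i; lia.
by rewrite opprK rmorphN mulNr mulrN.
Qed.

(** With denominators cleared, Q divides P U times z^{D-M} [rev_poly M Q]. At a root of Q, which
    lies outside the closed disk, this last factor is z^D Q(1/z), nonzero since 1/z lies in the
    disk; so it is coprime to Q. *)
Lemma dvdp_denominator (R : realType) (M D : nat) (Q P : {poly R[i]}) (u pt : int -> R[i]) :
  (M <= D)%N -> Q`_0 = 1 -> (size Q <= M.+1)%N -> (size P <= D.+1)%N ->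
  (forall z : R[i], `|z| <= 1 -> Q.[z] != 0) ->
  (forall x, teval D (Phat M D Q P) x * teval M u x = teval D pt x * teval M (Qhat M Q) x) ->
  Q %| P * \poly_(i < M.*2.+1) u (i%:Z - M%:Z).
Proof.
move=> MD Q0 sQ sP hQ FE; set U := \poly_(i < _) _.
pose W := \poly_(i < D.*2.+1) pt (i%:Z - D%:Z).
have E : 2%:P * W * (Q * rev_poly M Q) =
    (P * ('X^(D - M) * rev_poly M Q) + rev_poly D P * Q) * U.
  apply: circle_poly_eq => x; have := FE x; rewrite teval_Phat // teval_Qhat //.
  rewrite !(hornerM, hornerD, hornerC, hornerXn) !horner_rev_poly ?cis_neq0 //.
  rewrite -[U.[_]]tevalE -[W.[_]]tevalE -(subnK MD) exprD subnK //.
  move: (cis x ^+ (D - M)) (cis x ^+ M) (teval D pt x) (teval M u x) => b c tp tu FEx.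
  have -> : 2 * (tp * (b * c)) * (Q.[cis x] * (c * Q.[(cis x)^-1])) =
    2 * b * c * c * (tp * (Q.[cis x] * Q.[(cis x)^-1])) by ring.
  by rewrite -FEx; field.
have cop : coprimep Q ('X^(D - M) * rev_poly M Q).
  apply: Pdiv.ClosedField.root_coprimep => z; rewrite rootE => Qz.
  have z1 : 1 < `|z|.
    by rewrite real_ltNge ?normr_real ?real1 //; apply/negP => /hQ; rewrite Qz.
  have z0 : z != 0 by rewrite -normr_gt0 (lt_trans _ z1).
  rewrite hornerM hornerXn horner_rev_poly // !mulf_neq0 ?expf_neq0 // hQ //.
  by rewrite normfV ltW // invf_lt1 // (lt_trans ltr01).
rewrite -(Gauss_dvdpl _ cop).
have -> : P * U * ('X^(D - M) * rev_poly M Q) =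
  Q * (2%:P * W * rev_poly M Q - rev_poly D P * U).
  have -> : Q * (2%:P * W * rev_poly M Q - rev_poly D P * U) =
    2%:P * W * (Q * rev_poly M Q) - rev_poly D P * Q * U by ring.
  by rewrite E; ring.
by rewrite dvdp_mulr.
Qed.

(** With w the expansion of P/Q, the series U w is A = P U / Q; truncating w to a polynomial lets
    the ring laws apply. *)
Lemma conv_poly_assoc (R : comNzRingType) (Q P U A : {poly R}) (w : nat -> R) (l : nat) :
  Q`_0 = 1 -> (forall l, \sum_(q < l.+1) Q`_q * w (l - q)%N = P`_l) -> P * U = A * Q ->
  \sum_(q < l.+1) U`_q * w (l - q)%N = A`_l.
Proof.
move=> Q0 hw e; pose T := \poly_(i < l.+1) w i.
have cT (p : {poly R}) i : (i <= l)%N -> (p * T)`_i = \sum_(q < i.+1) p`_q * w (i - q)%N.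
  move=> il; rewrite coefM; apply: eq_bigr => q _.
  by rewrite coef_poly ltnS (leq_trans (leq_subr _ _) il).
rewrite -cT //; apply: (conv_inj (a := fun i => (U * T)`_i) (b := fun i => A`_i) Q0 (N := l)) => // i il.
rewrite -!coefM mulrA [Q * U]mulrC -mulrA [Q * A]mulrC -e [P * U]mulrC !coefM.
apply: eq_bigr => q _; congr (_ * _); rewrite cT ?hw //.
exact: leq_trans (leq_subr _ _) il.
Qed.

(** Extension by 0 to negative indices; a cosine series is then half the sum of a series in z and
    the same series in 1/z. *)
Definition one_sided (R : nmodType) (a : nat -> R) (p : int) : R :=
  if p is Posz q then a q else 0.

Lemma sum_one_sided (R : nzRingType) (c a : nat -> R) (L k : nat) :
  \sum_(i < L) c i * one_sided a (k%:Z - i%:Z) =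
  \sum_(q < k.+1) (\poly_(i < L) c i)`_q * a (k - q)%N.
Proof.
pose h i := if (i < L)%N && (i <= k)%N then c i * a (k - i)%N else 0.
transitivity (\sum_(i < L + k.+1) h i).
  rewrite (big_ord_widen (L + k.+1) (fun i => c i * one_sided a (k%:Z - i%:Z)) (leq_addr _ _)).
  rewrite big_mkcond; apply: eq_bigr => i _; rewrite /h; case: ltnP => //= iL.
  case: leqP => ik; first by rewrite subzn.
  have -> : k%:Z - i%:Z = Negz (i - k).-1 by lia.
  by rewrite /= mulr0.
symmetry; rewrite (big_ord_widen (L + k.+1) (fun q => (\poly_(i < L) c i)`_q * a (k - q)%N) (leq_addl _ _)).
rewrite big_mkcond; apply: eq_bigr => i _; rewrite /h coef_poly ltnS.
by case: leqP => ik; case: ltnP => iL //=; rewrite mul0r.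
Qed.

Lemma sum_one_sided_neg (R : nzRingType) (c a : nat -> R) (L k l : nat) : (k < l)%N ->
  \sum_(i < L) c i * one_sided a (k%:Z - i%:Z - l%:Z) = 0.
Proof.
move=> kl; rewrite big1 // => i _.
have -> : k%:Z - i%:Z - l%:Z = Negz (l + i - k).-1 by lia.
by rewrite /= mulr0.
Qed.

Lemma cos_series_one_sided (R : realType) (a : nat -> R[i]) (p : int) :
  2 * cos_series a p = one_sided a p + one_sided a (- p).
Proof.
rewrite /cos_series; case: p => [[|q]|q].
- by rewrite eqxx /= mulr_natl mulr2n.
- by rewrite /= addr0; field.
- by rewrite /= add0r; field.
Qed.

(* With P U = A Q and P V = B Q, the product of [u] by the expansion of P / Q is
   half of z^-M A(z) + z^M B(1/z), which must be [pt]; so the HP conditions only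
   involve the tail of [a] beyond the order N. *)
Lemma HP_hat_half (R : realType) (M D N : nat) (Q P : {poly R[i]}) (a : nat -> R[i])
    (u pt : int -> R[i]) :
  (M <= D)%N -> (D <= N)%N -> Q`_0 = 1 -> (size Q <= M.+1)%N -> (size P <= D.+1)%N ->
  (forall z : R[i], `|z| <= 1 -> Q.[z] != 0) ->
  (forall l, (l <= N)%N -> \sum_(q < l.+1) Q`_q * a (l - q)%N = P`_l) ->
  \sum_(q < N.+2) Q`_q * a (N.+1 - q)%N <> 0 ->
  tpoly D pt ->
  (forall l : int, (`|l| <= N)%N -> tmul M u (cos_series a) l - pt l = 0) ->
  (forall x, teval D (Phat M D Q P) x * teval M u x = teval D pt x * teval M (Qhat M Q) x) ->
  forall i, (i < M)%N -> u (i%:Z - M%:Z) = 0.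
Proof.
move=> MD DN Q0 sQ sP hQ hP rem tpt HP FE.
have MN := leq_trans MD DN.
set U := \poly_(i < M.*2.+1) u (i%:Z - M%:Z).
set V := \poly_(i < M.*2.+1) u (- (i%:Z - M%:Z)).
have [w [hw _]] := power_series_quotient P Q0 hQ.
have aw l : (l <= N)%N -> a l = w l.
  by move: l; apply: (conv_inj (Q := Q)) => // i iN; rewrite hP // hw.
have FE' x : teval D (Phat M D Q P) x * teval M (fun p => u (- p)) x =
    teval D (fun p => pt (- p)) x * teval M (Qhat M Q) x.
  have := FE (- x); rewrite !teval_opp !teval_Phat // !teval_Qhat // cisN invrK => e.
  rewrite [Q.[cis x] * _]mulrC -e; congr (_ / _ * _).
  by rewrite addrC.
have /dvdpP[A AE] := dvdp_denominator MD Q0 sQ sP hQ FE; rewrite -/U in AE.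
have /dvdpP[B BE] := dvdp_denominator MD Q0 sQ sP hQ FE'; rewrite -/V in BE.
have cU l := conv_poly_assoc l Q0 hw AE.
have cV l := conv_poly_assoc l Q0 hw BE.
have z1 (x : R) : `|(cis x)^-1| = 1 by rewrite normfV norm_cis invr1.
(* An exponent large enough for z^K to clear all negative powers: [E] is z^K times the identity 2 pt
   = z^-M A(z) + z^M B(1/z). *)
pose K := (D + size A + size B)%N.
pose W := \poly_(i < D.*2.+1) pt (i%:Z - D%:Z).
have E : 2%:P * W * 'X^(K - D) = A * 'X^(K - M) + rev_poly (K + M) B.
  apply: circle_poly_eq => x; have cx0 := cis_neq0 x.
  have q1 : Q.[cis x] != 0 by rewrite hQ ?norm_cis.
  have q2 : Q.[(cis x)^-1] != 0 by rewrite hQ ?z1.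
  rewrite !(hornerM, hornerD, hornerC, hornerXn) horner_rev_poly //; last first.
    by rewrite /K; lia.
  have eA : A.[cis x] = P.[cis x] * (teval M u x * cis x ^+ M) / Q.[cis x].
    by apply: (mulIf q1); rewrite divfK // -hornerM -AE hornerM tevalE.
  have eB : B.[(cis x)^-1] = P.[(cis x)^-1] * (teval M u x / cis x ^+ M) / Q.[(cis x)^-1].
    apply: (mulIf q2); rewrite divfK // -hornerM -BE hornerM; congr (_ * _).
    have := tevalE M (fun p => u (- p)) (- x); rewrite teval_opp opprK cisN => <-.
    by rewrite exprVn.
  rewrite eA eB -[W.[_]]tevalE.
  have := FE x; rewrite teval_Phat // teval_Qhat // => FEx.
  have -> : cis x ^+ (K + M) = cis x ^+ K * cis x ^+ M by rewrite exprD.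
  have kd : cis x ^+ K = cis x ^+ (K - D) * cis x ^+ D.
    by rewrite -exprD subnK // /K -addnA leq_addr.
  have km : cis x ^+ K = cis x ^+ (K - M) * cis x ^+ M.
    by rewrite -exprD subnK // /K -addnA (leq_trans MD) // leq_addr.
  have m0 : cis x ^+ M != 0 by rewrite expf_neq0.
  have -> : 2 * (teval D pt x * cis x ^+ D) * cis x ^+ (K - D) =
     2 * teval D pt x * cis x ^+ K by rewrite kd; ring.
  have -> : teval D pt x = (P.[cis x] * Q.[(cis x)^-1] + P.[(cis x)^-1] * Q.[cis x]) / 2 *
      teval M u x / (Q.[cis x] * Q.[(cis x)^-1]).
    by rewrite FEx mulfK // mulf_neq0.
  rewrite {1}km km; move: (cis x ^+ (K - M)) (cis x ^+ M) m0 => b c c0.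
  by field; rewrite q1 q2 c0.
have ptE l : (l <= N)%N -> 2 * pt l%:Z = A`_(l + M) + (if (l <= M)%N then B`_(M - l) else 0).
  move=> lN; have := congr1 (fun p : {poly _} => p`_(K + l)) E.
  have KD : (D <= K)%N by rewrite /K -addnA leq_addr.
  have kd : (K + l < K - D)%N = false by apply/negbTE; lia.
  have km : (K + l < K - M)%N = false by apply/negbTE; lia.
  have -> : 2%:P * W * 'X^(K - D) = 2%:P * (W * 'X^(K - D)) by rewrite mulrA.
  rewrite /= coefD coefCM !coefMXn kd km.
  have -> : (K + l - (K - D) = l + D)%N by clear -KD; lia.
  have -> : (K + l - (K - M) = l + M)%N by clear -KD MD; lia.
  rewrite /W /rev_poly !coef_poly.
  have -> : (K + l < (K + M).+1)%N = (l <= M)%N by lia.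
  have -> : (K + M - (K + l) = M - l)%N by lia.
  move=> <-; congr (_ * _); case: ltnP => lD; first by congr pt; lia.
  by rewrite tpt //; lia.
(* In the condition at l >= 0, the part in 1/z involves indices at most M - l <= N, where [a] and
   [w] agree, so it cancels the [B] term of [ptE]. *)
have convE l : (l <= N)%N ->
    \sum_(q < (l + M).+1) U`_q * a (l + M - q)%N = \sum_(q < (l + M).+1) U`_q * w (l + M - q)%N.
  move=> lN; have hl : (`|l%:Z| <= N)%N by [].
  have := HP l%:Z hl; move/eqP; rewrite subr_eq0 => /eqP.
  move/(congr1 (fun v => 2 * v)); rewrite ptE // /tmul /zsum mulr_sumr.
  rewrite (eq_bigr (fun i : 'I_(M.*2.+1) =>
    u (i%:Z - M%:Z) * one_sided a ((l + M)%N%:Z - i%:Z) +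
    u (i%:Z - M%:Z) * one_sided a (i%:Z - M%:Z - l%:Z))); last first.
    move=> i _; rewrite mulrCA cos_series_one_sided mulrDr.
    by congr (_ * one_sided a _ + _ * one_sided a _); lia.
  rewrite big_split /= (sum_one_sided (fun i => u (i%:Z - M%:Z))) -/U cU.
  have -> : \sum_(i < M.*2.+1) u (i%:Z - M%:Z) * one_sided a (i%:Z - M%:Z - l%:Z) =
     if (l <= M)%N then B`_(M - l) else 0.
    rewrite (reindex_inj rev_ord_inj) /=.
    rewrite (eq_bigr (fun i : 'I_(M.*2.+1) => u (- (i%:Z - M%:Z)) *
      one_sided a (M%:Z - i%:Z - l%:Z))); last first.
      move=> i _; have iM := ltn_ord i.
      by congr (u _ * one_sided a _); lia.
    case: leqP => lM; last exact: (sum_one_sided_neg (fun i => u (- (i%:Z - M%:Z)))).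
    rewrite (eq_bigr (fun i : 'I_(M.*2.+1) => u (- (i%:Z - M%:Z)) *
      one_sided a ((M - l)%N%:Z - i%:Z))); last first.
      by move=> i _; congr (_ * one_sided a _); lia.
    rewrite (sum_one_sided (fun i => u (- (i%:Z - M%:Z)))) -/V -cV.
    apply: eq_bigr => q _; rewrite aw //.
    by apply: leq_trans (leq_subr _ _) _; apply: leq_trans (leq_subr _ _) _.
  by move/addIr.
pose del i := a i - w i.
have del0 i : (i <= N)%N -> del i = 0 by move=> iN; rewrite /del aw // subrr.
have delN : del N.+1 != 0.
  apply/eqP => e; apply: rem; have := hw N.+1; rewrite [P`_ _]nth_default; last first.
    by apply: leq_trans sP _; rewrite ltnS.
  move=> hw0; rewrite -[RHS]hw0 [LHS]big_ord_recl [RHS]big_ord_recl /= !subn0; congr (_ * _ + _).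
    by apply/eqP; rewrite -subr_eq0; apply/eqP.
  by apply: eq_bigr => q _; rewrite aw // /bump /= add1n subSS leq_subr.
(* Take l = N + 1 + i - M. The discrepancy [del] vanishes up to N, so terms with q > i drop out, and
   those with q < i vanish by induction; what remains is U_i times [del] at N + 1. *)
have Ui i : (i < M)%N -> U`_i = 0.
  have [k] := ubnP i; elim: k i => // k IH i ik iM.
  have : (N.+1 + i - M <= N)%N by lia.
  move/convE; have -> : (N.+1 + i - M + M = N.+1 + i)%N by lia.
  move/eqP; rewrite -subr_eq0 -sumrB.
  have iN : (i < (N.+1 + i).+1)%N by rewrite ltnS leq_addl.
  rewrite (bigD1 (Ordinal iN)) //= big1 ?addr0; last first.
    move=> q /eqP qi; rewrite -mulrBr -/(del _).
    have [qi'|qi'] := ltnP q i; first by rewrite IH ?mul0r //; lia.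
    have neq : (q : nat) <> i by move=> e; apply: qi; apply: val_inj.
    by rewrite del0 ?mulr0 //; lia.
  rewrite -mulrBr addnK -/(del _) mulf_eq0 (negPf delN) orbF => /eqP //.
move=> i iM; have := Ui i iM; rewrite coef_poly ifT //; lia.
Qed.

(** Applied to u and to its reflection, [HP_hat_half] leaves only u_0. As D < N, the condition at
    the order N reads u_0 a_N / 2 = 0, which makes u zero. *)
Lemma HP_approx_not_hat (R : realType) (M D N : nat) (Q P : {poly R[i]}) (a : nat -> R[i])
    (u pt : int -> R[i]) :
  (M <= D)%N -> (D < N)%N -> Q`_0 = 1 -> (size Q <= M.+1)%N -> (size P <= D.+1)%N ->
  (forall z : R[i], `|z| <= 1 -> Q.[z] != 0) ->
  (forall l, (l <= N)%N -> \sum_(q < l.+1) Q`_q * a (l - q)%N = P`_l) ->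
  \sum_(q < N.+2) Q`_q * a (N.+1 - q)%N <> 0 -> a N != 0 ->
  tpoly M u -> (exists p, u p != 0) -> tpoly D pt ->
  (forall l : int, (`|l| <= N)%N -> tmul M u (cos_series a) l - pt l = 0) ->
  (forall x, teval D (Phat M D Q P) x * teval M u x = teval D pt x * teval M (Qhat M Q) x) ->
  False.
Proof.
move=> MD DN Q0 sQ sP hQ hP rem aN tu [p0 up0] tpt HP FE.
have neg := HP_hat_half MD (ltnW DN) Q0 sQ sP hQ hP rem tpt HP FE.
have pos : forall i, (i < M)%N -> u (- (i%:Z - M%:Z)) = 0.
  apply: (HP_hat_half (u := fun p => u (- p)) (pt := fun p => pt (- p))
    MD (ltnW DN) Q0 sQ sP hQ hP rem).
  - by move=> p pD; rewrite tpt // abszN.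
  - move=> l lN; rewrite -(HP (- l)); last by rewrite abszN.
    congr (_ - _); rewrite /tmul /zsum [RHS](reindex_inj rev_ord_inj) /=.
    apply: eq_bigr => i _; have iM := ltn_ord i; congr (u _ * _); first by lia.
    rewrite /cos_series.
    have -> : - l - ((M.*2.+1 - i.+1)%N%:Z - M%:Z) = - (l - (i%:Z - M%:Z)) by lia.
    by rewrite oppr_eq0 abszN.
  - move=> x; have := FE (- x); rewrite !teval_opp !teval_Phat // !teval_Qhat // cisN invrK => e.
    rewrite [Q.[cis x] * _]mulrC -e; congr (_ / _ * _).
    by rewrite addrC.
have u0 p : p != 0 -> u p = 0.
  move=> p0'; have [pM|pM] := ltnP M `|p|; first exact: tu.
  case: p p0' pM => q /= q0 qM.
    have -> : Posz q = - ((M - q)%N%:Z - M%:Z) by lia.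
    by apply: pos; lia.
  have -> : Negz q = ((M - q.+1)%N%:Z - M%:Z) by lia.
  by apply: neg; lia.
have NN : (`|N%:Z| <= N)%N by [].
have := HP N%:Z NN; rewrite tpt // subr0 /tmul /zsum.
have MM : (M < M.*2.+1)%N by lia.
rewrite (bigD1 (Ordinal MM)) //= big1 ?addr0; last first.
  move=> i /eqP iM; rewrite u0 ?mul0r //; apply/eqP => e; apply: iM; apply: val_inj => /=; lia.
rewrite subrr subr0 /cos_series ifF; last by apply/negbTE/eqP; lia.
move/eqP; rewrite mulf_eq0 mulf_eq0 (negPf aN) invr_eq0 pnatr_eq0 /= orbF => /eqP u00.
by move: up0; have [->|/u0 ->] := eqVneq p0 0; rewrite ?u00 eqxx.
Qed.

(** * Trigonometric Hermite--Jacobi approximations of the cosine series *)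

Unset Implicit Arguments.

Theorem theorem4 (R : realType) (k : nat) (hk : (1 <= k)%N)
    (g : R) (hg : forall p : nat, g <> - p%:R)
    (lam : 'I_k -> R) (lam_inj : injective lam) (lam_neq0 : forall j, lam j <> 0) :
  exists n0 : nat, forall (n : nat) (m : 'I_k -> nat),
    (n0 <= n)%N ->
    (exists j, m j <> 0%N) ->
    (forall j, (m j <= n)%N) ->
    exists Q : {poly R[i]},
      unique (HP_denominator_normalized (fun j => Ecoef g (lam j)) n m) Q /\
      exists (Qh : int -> R[i]) (Ph : 'I_k -> int -> R[i]),
        [/\ HJ_approx (fun j => Gseries g (lam j)) n m Qh Ph,
            forall x : R,
              teval (mtotal m) Qh x = Q.[cis x] * (Q.[cis x])^*,
            (* the integral itself, wherever it converges *)
            forall x : R, 0 < cos x ->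
              exists2 I : R[i],
                is_Cintegral `[0, +oo[
                  (fun t => (Ugamma g lam n m t)%:C *
                            Cexp (- (t%:C * (cos x +i* sin x)))) I &
                teval (mtotal m) Qh x =
                  (1 / EulerGamma ((n + mtotal m)%:R + g) ^+ 2)%:C * `|I| ^+ 2,
            (* for every x, the integral understood by analytic continuation *)
            exists2 F : R[i] -> R[i],
              laplace_continuation (Ugamma g lam n m) F &
              forall x : R,
                teval (mtotal m) Qh x =
                  (1 / EulerGamma ((n + mtotal m)%:R + g) ^+ 2)%:C
                    * `|F (0 +i* x)| ^+ 2
          & (forall j, 0 < lam j) ->
            (forall i j : 'I_k, (i < j)%N -> lam i < lam j) ->
            exists j : 'I_k,
              ~ exists (Qt : int -> R[i]) (Pt : 'I_k -> int -> R[i]),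
                  HP_approx (fun i => Gseries g (lam i)) n m Qt Pt /\
                  same_fraction (ndeg n m j) (mtotal m)
                    (Ph j) Qh (Pt j) Qt].
Proof.
have hl0 j : lam j != 0 by apply/eqP; exact: lam_neq0.
have [n0 hn0] := HPden_neq0 hg lam_neq0.
exists n0 => n m n0n [j0 mj0] mn.
have [n1 Qn0] := hn0 n m n0n mn.
have hu := HPden_HP hg lam_inj lam_neq0 mn.
have [[[_ sQ [P hP]] Q1] _] := hu.
set Q := HPden g lam n m in Qn0 hu sQ hP Q1.
exists Q; split => //.
have Q0 : Q`_0 = 1 by rewrite -horner_coef0.
have cisV (x : R) : (cis x)^-1 = (cis x)^* by rewrite conj_cis cisN.
(* The coefficients of Q are real, so Q(e^{-ix}) is the conjugate of Q(e^{ix}). *)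
have Qreal (z : R[i]) : Q.[z^*] = (Q.[z])^*.
  rewrite horner_conj_real // => q; rewrite coef_poly.
  by case: ifP => _; [exact: conjc_real | exact: conjc0].
have Qh_norm x : teval (mtotal m) (Qhat (mtotal m) Q) x = `|Q.[cis x]| ^+ 2.
  by rewrite teval_Qhat // cisV Qreal -normCK.
exists (Qhat (mtotal m) Q), (fun j => Phat (mtotal m) (ndeg n m j) Q (P j)); split.
- exact: HJ_approx_hat.
- by move=> x; rewrite teval_Qhat // cisV Qreal.
- move=> x x0; have [I hI eI] := is_Cintegral_HPden m lam_neq0 hg n1 x0.
  by exists I => //; rewrite Qh_norm.
- exists (laplace_ext g lam n m); first exact: laplace_continuation_ext.
  by move=> x; rewrite Qh_norm norm_laplace_ext.
move=> lam_gt0 lam_mono.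
pose pm (i : 'I_k) := m i != 0%N.
have pj0 : pm j0 by apply/eqP.
have [j mj jmin] := arg_minnP (fun i : 'I_k => i : nat) pj0.
exists j => -[Qt [Pt [[tQ exQ tP hQP] sf]]].
have mM : (m j <= mtotal m)%N by rewrite /mtotal (bigD1 j) //= leq_addr.
have mj1 : (0 < m j)%N by rewrite lt0n.
have MD : (mtotal m <= ndeg n m j)%N by have := mn j; rewrite /ndeg; lia.
(* Here m_j > 0 makes n_j < n + m strict, so [Pt j] has no coefficient at the order n + m. *)
have DN : (ndeg n m j < n + mtotal m)%N by rewrite /ndeg; lia.
have [sPj hPj] := hP j.
have lj i : m i <> 0%N -> lam j <= lam i.
  move=> /eqP /jmin; rewrite leq_eqVlt => /predU1P[/val_inj ->|/lam_mono /ltW //].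
  exact: lexx.
have rem := HPden_remainder_neq0 hg lam_neq0 n1 (lam_gt0 j) lj.
apply: (HP_approx_not_hat MD DN Q0 sQ sPj Qn0 hPj rem _ tQ exQ (tP j) (hQP j)).
  rewrite /Ecoef fmorph_eq0 mulf_eq0 negb_or expf_neq0 //= invr_eq0.
  exact: pochhammer_neq0.
exact: sf.
Qed.
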